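(* Let $d\ge 2$ and $K,N,M\in\mathbb{N}$ with $M\le K$. Let $$P(\mathbf{x})=\sum_{\mathbf{k}\in(\mathbb{Z}\cap[-K,K])^d} c_{\mathbf{k}}e^{2\pi i\mathbf{k}\cdot\mathbf{x}/N},\qquad\mathbf{x}\in\mathbb{R}^d,$$ be a real-valued trigonometric polynomial with $c_{\mathbf{k}}=\frac{1}{N^d}\delta_{\mathbf{k},\mathbf{0}}$ for all $\mathbf{k}\in(N\mathbb{Z})^d$ and with $P\chi_{[0,N]^d}\in C^{2M-1}(\mathbb{R}^d)$. Suppose $P(\mathbf{x})=\prod_{j=1}^d\sin^{2M}(\pi x_j/N)\,G(\mathbf{x})H(\mathbf{x})$ for some $(N\mathbb{Z})^d$-periodic real-valued trigonometric polynomials $G,H$. Let $B$ be a real invertible $d\times d$ matrix such that $(B^T)^{-1}\mathbf{n}\notin(-N,N)^d$ for all $\mathbf{n}\in\mathbb{Z}^d\setminus\{\mathbf{0}\}$. Define $$g(\mathbf{x})=\Big(\prod_{j=1}^d\sin^M(\pi x_j/N)\Big)G(\mathbf{x})\chi_{[0,N]^d}(\mathbf{x}),\qquad h(\mathbf{x})=|\det B|\Big(\prod_{j=1}^d\sin^M(\pi x_j/N)\Big)H(\mathbf{x})\chi_{[0,N]^d}(\mathbf{x}).$$ Then $g,h\in C^{M-1}(\mathbb{R}^d)$, and the Gabor systems $\{E_{B\mathbf{m}}T_{\mathbf{n}}g\}_{\mathbf{m},\mathbf{n}\in\mathbb{Z}^d}$ and $\{E_{B\mathbf{m}}T_{\mathbf{n}}h\}_{\mathbf{m},\mathbf{n}\in\mathbb{Z}^d}$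 form dual frames for $L^2(\mathbb{R}^d)$.
   Context: An $(N\mathbb{Z})^d$-periodic trigonometric polynomial is a finite sum $\sum_{\mathbf{k}} a_{\mathbf{k}}e^{2\pi i\mathbf{k}\cdot\mathbf{x}/N}$, $\mathbf{k}\in\mathbb{Z}^d$. For $\mathbf{y}\in\mathbb{R}^d$, $(T_{\mathbf{y}}f)(\mathbf{x})=f(\mathbf{x}-\mathbf{y})$ and $(E_{\mathbf{y}}f)(\mathbf{x})=e^{2\pi i\mathbf{y}\cdot\mathbf{x}}f(\mathbf{x})$ on $L^2(\mathbb{R}^d)$. Two Bessel sequences $\{f_i\}$, $\{h_i\}$ in a Hilbert space $\mathcal H$ are dual frames if $f=\sum_i\langle f,h_i\rangle f_i$ for all $f\in\mathcal H$. $C^m(\mathbb{R}^d)$ denotes functions with continuous partial derivatives of total order at most $m$; $\chi_{[0,N]^d}$ is the indicator of $[0,N]^d$. *)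

(* Defs.v *)
From HB Require Import structures.
From mathcomp Require Import all_boot all_order all_algebra.
From mathcomp Require Import all_classical all_reals all_analysis.
From mathcomp Require Import complex.
Set Implicit Arguments. Unset Strict Implicit. Unset Printing Implicit Defensive.
Import Order.TTheory GRing.Theory Num.Theory.
Import numFieldNormedType.Exports.
Local Open Scope classical_set_scope.
Local Open Scope ring_scope.
Local Open Scope complex_scope.

Section Defs.
Variables (R : realType) (d : nat).

Definition intv (n : 'rV[int]_d) : 'rV[R]_d := map_mx (fun z : int => z%:~R) n.
Definition dotR (x y : 'rV[R]_d) : R := \sum_(i < d) x 0 i * y 0 i.
Definition matv (B : 'M[R]_d) (y : 'rV[R]_d) : 'rV[R]_d := (B *m y^T)^T.

Definition cconj (z : R[i]) : R[i] := complex.Re z -i* complex.Im z.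
Definition cnorm2 (z : R[i]) : R := complex.Re z ^+ 2 + complex.Im z ^+ 2.
Definition e2pi (t : R) : R[i] := cos (2 * pi * t) +i* sin (2 * pi * t).

Definition real_trig_poly (N : nat) (f : 'rV[R]_d -> R) : Prop :=
  exists (S : seq 'rV[int]_d) (a : 'rV[int]_d -> R[i]),
    forall x, (f x)%:C = \sum_(k <- S) a k * e2pi (dotR (intv k) x / N%:R).

Definition chi_cube (N : nat) (x : 'rV[R]_d) : R :=
  if `[< forall i, 0 <= x 0 i <= N%:R >] then 1 else 0.

Definition sin_prod (N : nat) (x : 'rV[R]_d) : R :=
  \prod_(j < d) sin (pi * x 0 j / N%:R).

Fixpoint Cm (m : nat) (f : 'rV[R]_d -> R) : Prop :=
  match m with
  | 0 => continuous f
  | m'.+1 => continuous f /\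
      forall i : 'I_d, (forall x, derivable f x (delta_mx 0 i)) /\
                       Cm m' (fun x => 'D_(delta_mx 0 i) f x)
  end.

Definition Ty (y : 'rV[R]_d) (f : 'rV[R]_d -> R[i]) : 'rV[R]_d -> R[i] :=
  fun x => f (x - y).
Definition Ey (y : 'rV[R]_d) (f : 'rV[R]_d -> R[i]) : 'rV[R]_d -> R[i] :=
  fun x => e2pi (dotR y x) * f x.

Definition gabor (B : 'M[R]_d) (g : 'rV[R]_d -> R[i])
  : 'rV[int]_d * 'rV[int]_d -> 'rV[R]_d -> R[i] :=
  fun mn => Ey (matv B (intv mn.1)) (Ty (intv mn.2) g).

Definition Rd := g_sigma_algebraType (@open 'rV[R]_d).

(* the Lebesgue measure on the Borel sets of R^d is characterised as the
   measure giving every closed box its volume *)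
Definition is_lebesgue_Rd (mu : {measure set Rd -> \bar R}) : Prop :=
  forall a b : 'rV[R]_d,
    mu [set x : Rd | forall i, a 0 i <= x 0 i <= b 0 i] =
    (\prod_(i < d) Num.max (b 0 i - a 0 i) 0)%:E.

Section L2.
Variable mu : {measure set Rd -> \bar R}.

Definition L2 (f : 'rV[R]_d -> R[i]) : Prop :=
  measurable_fun [set: Rd] (fun x : Rd => complex.Re (f x)) /\
  measurable_fun [set: Rd] (fun x : Rd => complex.Im (f x)) /\
  (\int[mu]_x (cnorm2 (f x))%:E < +oo)%E.

Definition inner (f g : 'rV[R]_d -> R[i]) : R[i] :=
  Rintegral mu [set: Rd] (fun x : Rd => complex.Re (f x * cconj (g x))) +i*
  Rintegral mu [set: Rd] (fun x : Rd => complex.Im (f x * cconj (g x))).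

Definition L2norm (f : 'rV[R]_d -> R[i]) : R :=
  Num.sqrt (Rintegral mu [set: Rd] (fun x : Rd => cnorm2 (f x))).

(* Bessel sequence in L^2(R^d), indexed by a (countable) type I;
   the sum over I is the supremum of finite partial sums *)
Definition bessel (I : eqType) (F : I -> 'rV[R]_d -> R[i]) : Prop :=
  (forall i, L2 (F i)) /\
  exists C : R, forall f, L2 f ->
    forall s : seq I, uniq s ->
      \sum_(i <- s) cnorm2 (inner f (F i)) <= C * L2norm f ^+ 2.

(* dual frames: f = sum_i <f, h_i> f_i in L^2, the series converging
   (unconditionally) in L^2 norm *)
Definition dual_frames (I : eqType) (F H : I -> 'rV[R]_d -> R[i]) : Prop :=
  bessel F /\ bessel H /\
  forall f, L2 f -> forall eps : R, 0 < eps ->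
    exists s0 : seq I, forall s : seq I, uniq s -> {subset s0 <= s} ->
      L2norm (fun x => f x - \sum_(i <- s) inner f (H i) * F i x) < eps.
End L2.

Definition box_pt (K : nat) (j : {ffun 'I_d -> 'I_(K.*2.+1)}) : 'rV[int]_d :=
  \row_i ((j i : nat)%:Z - K%:Z).

End Defs.

Arguments intv {R d} n.
Arguments dotR {R d} x y.
Arguments matv {R d} B y.
Arguments e2pi {R} t.
Arguments real_trig_poly {R d} N f.
Arguments chi_cube {R d} N x.
Arguments sin_prod {R d} N x.
Arguments Cm {R d} m f.
Arguments gabor {R d} B g mn.
Arguments is_lebesgue_Rd {R d} mu.
Arguments L2 {R d} mu f.
Arguments inner {R d} mu f g.
Arguments L2norm {R d} mu f.
Arguments bessel {R d} mu {I} F.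
Arguments dual_frames {R d} mu {I} F H.
Arguments box_pt {d K} j.

(* Main.v *)
Require Import Defs.
From HB Require Import structures.
From mathcomp Require Import all_boot all_order all_algebra.
From mathcomp Require Import all_classical all_reals all_analysis.
From mathcomp Require Import measurable_realfun complex.
From mathcomp Require Import fingroup perm.
From mathcomp Require Import ring lra zify.
Import Order.TTheory GRing.Theory Num.Theory.
Import numFieldNormedType.Exports HBNNSimple.
Set Implicit Arguments. Unset Strict Implicit. Unset Printing Implicit Defensive.
Local Open Scope classical_set_scope.
Local Open Scope ring_scope.
Local Open Scope complex_scope.

(** For fixed [n] the cube [n + (0,N)^d] is disjoint from its translates by the
    lattice [(B^T)^-1 Z^d], so it lies in a fundamental domain [D] of that
    lattice.  On [D] the characters [e^(2 pi i Bm.x)] are orthogonal with squared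
    norm [|D| = 1 / |det B|], and complete.  Bessel's inequality on [D] for
    [f * T_n g], summed over [n], gives the Bessel bounds.  Expanding [f * T_n h]
    in the characters, multiplying by [T_n g] and summing over [n] gives back [f],
    because [sum_n T_n (g h) = |det B| sum_n T_n (P chi) = |det B|]: summing [P]
    over the translates by [{0, ..., N-1}^d] kills the frequencies outside
    [(N Z)^d].  Only finitely many [n] matter when [f] has bounded support, and
    the partial sums are uniformly bounded operators, which handles general [f].

    Completeness: for a trigonometric polynomial [t] with values in [[0,1]], the
    polynomials [(1 - t^n)^(n 2^n)] converge boundedly and pointwise to the
    indicator of [t < 1/2]; these sets generate the periodic Borel sets. *)

(** * Borel sets and Lebesgue measure on R^d *)

Section Borel.
Context {R : realType} {d : nat}.
Notation T := (Rd R d).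

(** [mu] is known only through the volumes of closed boxes. Translation invariance comes from
    uniqueness of measures, and the volume of a fundamental domain from a triangular factorisation
    of the matrix, for which points can be reduced one coordinate at a time. The domain [D] depends
    on [n]: it completes the translated cube. Open cubes are enough although the windows are cut off
    on closed ones, because a positive power of each sine makes the windows vanish on the faces; two
    points of an open cube differ by a vector of [(-N,N)^d], where the condition on [B] allows no
    nonzero lattice vector. Convergence is unconditional, so the error has to be small for every
    finite index set beyond a fixed one: orthogonal projection gives the best approximation from a
    span, hence once the frequencies of one good approximant are included, every larger set does at
    least as well. Smoothness rests on a dichotomy: the indicator of the cube is constant near a
    point, or the sine product vanishes at that point. *)

Definition cbox (a b : 'rV[R]_d) : set T := [set x | forall i, a 0 i <= x 0 i <= b 0 i].

(** Cells are closed so that they are instances of [cbox]; neighbours overlap in faces, which does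
    no harm in a union. The index type is countable. *)
Definition grid_cell (p : nat * 'rV[int]_d) : set T :=
  cbox (\row_i ((p.2 0 i)%:~R / p.1.+1%:R)) (\row_i ((p.2 0 i + 1)%:~R / p.1.+1%:R)).

(** In the sup norm a cell of mesh less than [e] through [x] stays in the ball of radius [e], and
    rounding down the scaled coordinates of [x] finds such a cell. *)
Lemma open_grid_cells (U : set 'rV[R]_d) : open U ->
  U = \bigcup_(p in [set: nat * 'rV[int]_d])
        (if `[< grid_cell p `<=` U >] then grid_cell p else set0).
Proof.
move=> oU; apply/seteqP; split=> [x Ux|x [p _]]; last first.
  by case: asboolP => // + px; apply.
have /nbhs_ballP [e /= e0 xeU] := open_nbhs_nbhs (conj oU Ux).
have [k ke] : exists k : nat, k.+1%:R^-1 < e.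
  have [k _ hk] := near_infty_natSinv_lt (PosNum e0).
  by exists k; exact: (hk k (leqnn k)).
have k0 : 0 < k.+1%:R :> R by rewrite ltr0n.
pose n : 'rV[int]_d := \row_i Num.floor (x 0 i * k.+1%:R).
have cellU : grid_cell (k, n) `<=` U.
  move=> y yc; apply: xeU; split => // i j; rewrite ord1 /ball /=.
  have := yc j; rewrite !mxE /= ler_pdivrMr // ler_pdivlMr // => /andP[y1 y2].
  have /andP[x1 x2] := floor_itv (x 0 j * k.+1%:R).
  apply: le_lt_trans ke; rewrite -[_^-1]mul1r ler_pdivlMr // -[X in _ * X]gtr0_norm //.
  rewrite -normrM mulrBl ler_norml; apply/andP; split.
    rewrite intrD in y2; lra.
  rewrite intrD in x2; lra.
exists (k, n) => //; case: asboolP => // _ i; rewrite !mxE /=.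
have /andP[x1 x2] := floor_itv (x 0 i * k.+1%:R).
by rewrite ler_pdivrMr // ler_pdivlMr // x1 ltW.
Qed.

Lemma measurable_cbox a b : measurable (cbox a b).
Proof.
suff cb : closed (cbox a b : set 'rV[R]_d).
  rewrite -[cbox a b]setCK; apply: measurableC; apply: sub_sigma_algebra.
  exact: closed_openC.
rewrite (_ : cbox a b = \bigcap_(i in [set: 'I_d])
   ((fun x : 'rV[R]_d => x 0 i) @^-1` [set t | a 0 i <= t <= b 0 i])).
  apply: closed_bigI => i _; apply: preimage_closed => //.
    by move=> x _; exact: coord_continuous.
  rewrite (_ : [set _ | _] = [set` `[a 0 i, b 0 i]]); first exact: interval_closed.
  by apply/seteqP; split => t /=; rewrite in_itv.
by apply/seteqP; split=> [x h i _|x h i]; [exact: h|exact: h].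
Qed.

(** Closed boxes are the sets whose measure is given; having them as generators allows uniqueness of
    measures and coordinatewise tests of measurability. *)
Lemma measurable_Rd_cboxes :
  @measurable _ T = <<s [set E | exists a b, E = cbox a b] >>.
Proof.
apply/seteqP; split; last first.
  apply: smallest_sub; first exact: sigma_algebra_measurable.
  by move=> _ [a [b ->]]; exact: measurable_cbox.
apply: smallest_sub; first exact: smallest_sigma_algebra.
move=> U oU; rewrite (open_grid_cells oU).
set G := [set E | _].
apply: (@countable_bigcupT_measurable _ (g_sigma_algebraType G)) => //.
move=> p; case: asboolP => _; last exact: measurable0.
by apply: sub_sigma_algebra; eexists; eexists.
Qed.

Lemma measurable_fun_coords (disp : measure_display) (X : measurableType disp)
    (f : X -> T) :
  (forall i, measurable_fun [set: X] (fun x => (f x : 'rV[R]_d) 0 i)) ->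
  measurable_fun [set: X] f.
Proof.
move=> mf; apply: (measurability _ measurable_Rd_cboxes) => _ [_ [a [b ->]] <-].
rewrite setTI (_ : _ @^-1` _ = \bigcap_(i in [set: 'I_d])
   ([set: X] `&` (fun x => (f x : 'rV[R]_d) 0 i) @^-1` `[a 0 i, b 0 i])).
  apply: fin_bigcap_measurable; first exact: finite_finset.
  by move=> i _; exact: mf.
apply/seteqP; split=> [x h i _|x h i].
  by split => //=; rewrite in_itv; exact: h.
by have [_] := h i Logic.I; rewrite /= in_itv.
Qed.

Lemma continuous_measurable_Rd (f : 'rV[R]_d -> R) :
  continuous f -> measurable_fun [set: T] (f : T -> R).
Proof.
move=> cf; apply: (measurability _ (measurable_realfun.RGenOpens.measurableE R)) => _ [_ [a [b
  ->]] <-].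
rewrite setTI; apply: sub_sigma_algebra.
by move/continuousP : cf; apply; exact: interval_open.
Qed.

End Borel.

(** * Lattices, fundamental domains and their volume *)

Section Lattices.
Context {R : realType} {d : nat}.
Notation T := (Rd R d).
Implicit Types (A : 'M[R]_d) (D : set T) (n : 'rV[int]_d).

Lemma intv0 : intv 0 = 0 :> 'rV[R]_d.
Proof. by apply/rowP => i; rewrite !mxE. Qed.

Lemma intvD n m : intv (n + m) = intv n + intv m :> 'rV[R]_d.
Proof. by apply/rowP => i; rewrite !mxE intrD. Qed.

Lemma intvN n : intv (- n) = - intv n :> 'rV[R]_d.
Proof. by apply/rowP => i; rewrite !mxE mulrNz. Qed.

Lemma intvB n m : intv (n - m) = intv n - intv m :> 'rV[R]_d.
Proof. by rewrite intvD intvN. Qed.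

Definition translate (v : 'rV[R]_d) : T -> T := fun x => (x : 'rV[R]_d) + v.

Lemma measurable_coord (i : 'I_d) : measurable_fun [set: T] (fun x : T => (x : 'rV[R]_d) 0 i).
Proof. by apply: continuous_measurable_Rd; exact: coord_continuous. Qed.

Lemma measurable_translate v : measurable_fun [set: T] (translate v).
Proof.
apply: measurable_fun_coords => i; rewrite /translate.
under eq_fun do rewrite mxE.
by apply: measurable_funD; [exact: measurable_coord|exact: measurable_cst].
Qed.

Lemma measurable_mulmx A : measurable_fun [set: T] (fun x : T => (x : 'rV[R]_d) *m A : T).
Proof.
apply: measurable_fun_coords => i.
under eq_fun do rewrite mxE.
apply: measurable_sum => j; apply: measurable_funM; last exact: measurable_cst.
exact: measurable_coord.
Qed.

Lemma measurable_preimage disp (X : measurableType disp) disp' (Y : measurableType disp')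
    (f : X -> Y) (E : set Y) :
  measurable_fun [set: X] f -> measurable E -> measurable (f @^-1` E).
Proof. by move=> mf mE; rewrite -[X in measurable X]setTI; exact: mf. Qed.

(* [D] is a fundamental domain of the lattice [Z^d *m A] (row vectors); with
   [A = invmx B] this is the paper's lattice [(B^T)^-1 Z^d]. *)
Definition fundom A D := [/\ measurable D,
  forall x : 'rV[R]_d, exists n, D (x + intv n *m A) &
  forall (x : 'rV[R]_d) n, D x -> D (x + intv n *m A) -> n = 0].

Lemma fundom_mulmx A C D : fundom A D -> C \in unitmx ->
  fundom (A *m C) ((fun x : T => (x : 'rV[R]_d) *m invmx C : T) @^-1` D).
Proof.
move=> [mD exD unD] uC; split.
- by apply: measurable_preimage => //; exact: measurable_mulmx.
- move=> x; have [n Dn] := exD (x *m invmx C); exists n.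
  by rewrite /= mulmxDl mulmxA mulmxK.
- move=> x n /= Dx; rewrite mulmxDl mulmxA mulmxK //; exact: unD.
Qed.

Section Lebesgue.
Variable mu : {measure set T -> \bar R}.
Hypothesis lebmu : is_lebesgue_Rd mu.

Lemma translate_cbox v a b : translate v @^-1` cbox a b = cbox (a - v) (b - v).
Proof. by apply/seteqP; split => x h i; have := h i; rewrite !mxE lerBlDr lerBrDr. Qed.

(** A translate of a closed box is a closed box of the same volume. Closed boxes are stable under
    intersection and the cubes [g k] exhaust the space, so [mu] and its image under translation
    coincide. *)
Lemma mu_translate v E : measurable E -> mu (translate v @^-1` E) = mu E.
Proof.
move=> mE; rewrite -[LHS]/(pushforward mu (translate v) E).
have mE' : <<s [set E | exists a b, E = cbox a b] >> E.
  by rewrite -measurable_Rd_cboxes.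
pose g (k : nat) := cbox (\row_(i < d) - k%:R : 'rV[R]_d) (\row_(i < d) k%:R).
have mtranslate := @measurable_translate v.
apply: (g_sigma_algebra_measure_unique (T := T) [set E | exists a b, E = cbox a b] _ g _ _
  (pushforward mu (translate v)) mu) => //.
- by move=> _ [a [b ->]]; exact: measurable_cbox.
- by move=> i; eexists; eexists.
- apply/seteqP; split => // x _.
  pose k := (\max_(i < d) Num.trunc `|x ord0 i|)%N.+1.
  exists k => // i; rewrite !mxE -ler_norml ltW //.
  have /andP[_ h] := truncn_itv (normr_ge0 (x 0 i)).
  apply: (lt_le_trans h); rewrite ler_nat ltnS.
  exact: (@leq_bigmax _ (fun i : 'I_d => Num.trunc `|x ord0 i|) i).
- move=> _ _ [a [b ->]] [a' [b' ->]].
  exists (\row_i Num.max (a 0 i) (a' 0 i)), (\row_i Num.min (b 0 i) (b' 0 i)).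
  apply/seteqP; split=> [x [h h'] i|x h].
    by rewrite !mxE ge_max le_min; have := h i; have := h' i; do 2 case/andP => -> ->.
  by split => i; have := h i; rewrite !mxE ge_max le_min => /andP[/andP[? ?] /andP[? ?]];
    apply/andP.
- move=> _ [a [b ->]]; rewrite -[LHS]/(mu (translate v @^-1` cbox a b)).
  rewrite translate_cbox !lebmu; congr (_%:E).
  by apply: eq_bigr => i _; rewrite !mxE opprB addrA subrK.
- by move=> k; rewrite -[X in (X < _)%E]/(mu (translate v @^-1` g k)) translate_cbox lebmu ltry.
Qed.

Lemma integral_translate v (f : T -> \bar R) E : measurable E -> measurable_fun setT f ->
  (forall x, (0 <= f x)%E) ->
  (\int[mu]_(x in translate v @^-1` E) f (translate v x) = \int[mu]_(x in E) f x)%E.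
Proof.
move=> mE mf f0.
rewrite -(ge0_integral_pushforward (@measurable_translate v) mu mE (f := f)) //.
  have mtranslate := @measurable_translate v.
  by apply: eq_measure_integral => B mB _; exact: mu_translate.
by apply: measurable_funS mf.
Qed.

(** Each point of [D1] has a unique lattice translate in [D2]. This cuts both domains into countably
    many pieces that correspond under lattice translations, which preserve [f] and [mu]. *)
Lemma fundom_integral A D1 D2 (f : T -> \bar R) : fundom A D1 -> fundom A D2 ->
  measurable_fun setT f -> (forall x, (0 <= f x)%E) ->
  (forall (x : 'rV[R]_d) n, f (x + intv n *m A) = f x) ->
  (\int[mu]_(x in D1) f x = \int[mu]_(x in D2) f x)%E.
Proof.
move=> [mD1 ex1 un1] [mD2 ex2 un2] mf f0 fper.
(* Lattice vectors are enumerated by their codes in [nat]; a number that codes nothing gives the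
   empty piece. *)
pose F1 (k : nat) := if pickle_inv k is Some n
  then D1 `&` translate (intv (n : 'rV[int]_d) *m A) @^-1` D2 else set0.
pose F2 (k : nat) := if pickle_inv k is Some n
  then D2 `&` translate (- (intv (n : 'rV[int]_d) *m A)) @^-1` D1 else set0.
have pk k k' (n : 'rV[int]_d) : pickle_inv k = Some n -> pickle_inv k' = Some n -> k = k'.
  move=> h h'; have := @pickle_invK 'rV[int]_d k; have := @pickle_invK 'rV[int]_d k'.
  by rewrite /oapp h h' => -> ->.
have mF1 k : measurable (F1 k).
  rewrite /F1; case: pickle_inv => // n; apply: measurableI => //.
  by apply: measurable_preimage => //; exact: measurable_translate.
have mF2 k : measurable (F2 k).
  rewrite /F2; case: pickle_inv => // n; apply: measurableI => //.
  by apply: measurable_preimage => //; exact: measurable_translate.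
have E1 : D1 = \bigcup_k F1 k.
  apply/seteqP; split => [x Dx|x [k _]]; last by rewrite /F1; case: pickle_inv => // n [].
  have [n Dn] := ex2 x; exists (pickle n) => //.
  by rewrite /F1 pickleK_inv.
have E2 : D2 = \bigcup_k F2 k.
  apply/seteqP; split => [x Dx|x [k _]]; last by rewrite /F2; case: pickle_inv => // n [].
  have [n Dn] := ex1 x; exists (pickle (- n)) => //.
  by rewrite /F2 pickleK_inv; split => //; rewrite /translate /= intvN mulNmx opprK.
have T1 : trivIset setT F1.
  move=> k k' _ _ [x []]; rewrite /F1.
  case h : pickle_inv => [n|] // [_ h1]; case h' : pickle_inv => [n'|] // [_ h2].
  apply: (pk _ _ _ h); rewrite h'; congr Some; apply/eqP; rewrite -subr_eq0; apply/eqP.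
  apply: un2 h1 _; rewrite intvB mulmxBl (_ : _ + _ = translate (intv n' *m A) x) // /translate.
  by rewrite addrACA subrr addr0.
have T2 : trivIset setT F2.
  move=> k k' _ _ [x []]; rewrite /F2.
  case h : pickle_inv => [n|] // [_ h1]; case h' : pickle_inv => [n'|] // [_ h2].
  apply: (pk _ _ _ h); rewrite h'; congr Some; apply/eqP; rewrite -subr_eq0; apply/eqP.
  apply: un1 h2 _; rewrite intvB mulmxBl (_ : _ + _ = translate (- (intv n *m A)) x) // /translate.
  by rewrite addrA subrK.
rewrite [in LHS]E1 [in RHS]E2 !ge0_integral_bigcup //; try exact: measurable_funS mf.
apply: eq_eseriesr => k _; rewrite /F1 /F2; case: pickle_inv => [n|]; last first.
  by rewrite !integral_set0.
set v := intv n *m A.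
rewrite -(@integral_translate v f (D2 `&` translate (- v) @^-1` D1)) //; last first.
  apply: measurableI => //; apply: measurable_preimage => //; exact: measurable_translate.
rewrite [in RHS](_ : _ @^-1` _ = D1 `&` translate v @^-1` D2).
  by apply: eq_integral => x _; rewrite /translate fper.
apply/seteqP; split => x; rewrite /translate /= ?addrK; by case.
Qed.

Lemma fundom_mu A D1 D2 : fundom A D1 -> fundom A D2 -> mu D1 = mu D2.
Proof.
move=> f1 f2; have [mD1 _ _] := f1; have [mD2 _ _] := f2.
have := @fundom_integral A D1 D2 (cst 1%E) f1 f2 (measurable_cst _).
by rewrite !integral_cst // !mul1e; apply.
Qed.

(** Half-open, so that translates can tile the space without overlap. *)
Definition hbox (a b : 'rV[R]_d) : set T := [set x | forall i, a 0 i <= x 0 i < b 0 i].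

Lemma hbox_bigcup a b :
  hbox a b = \bigcup_k cbox a (\row_i (b 0 i - k.+1%:R^-1)).
Proof.
apply/seteqP; split => [x h|x [k _ h] i]; last first.
  have /andP[-> ] := h i; rewrite mxE => /le_lt_trans; apply.
  by rewrite ltrBlDr ltrDl invr_gt0 ltr0n.
have : \forall k \near \oo, forall i, x 0 i <= b 0 i - k.+1%:R^-1.
  apply: filter_forall => i; have /andP[_ h1] := h i.
  have := near_infty_natSinv_lt (PosNum (etrans (subr_gt0 _ _) h1)).
  apply: filterS => k /= /ltW hk; by rewrite lerBrDr addrC -lerBrDr.
by case=> k _ /(_ k (leqnn k)) hk; exists k => // i; rewrite mxE hk andbT; have /andP[] := h i.
Qed.

Lemma measurable_hbox a b : measurable (hbox a b).
Proof. by rewrite hbox_bigcup; apply: bigcupT_measurable => k; exact: measurable_cbox. Qed.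

(** Continuity of [mu] from below along the closed boxes of [hbox_bigcup], whose volumes converge
    factor by factor. *)
Lemma mu_hbox a b : mu (hbox a b) = (\prod_(i < d) Num.max (b 0 i - a 0 i) 0)%:E.
Proof.
rewrite hbox_bigcup.
have h : (mu \o (fun k : nat => cbox a (\row_i (b 0 i - k.+1%:R^-1)))) x @[x --> \oo] --> 
   mu (\bigcup_k cbox a (\row_i (b 0 i - k.+1%:R^-1))).
  apply: nondecreasing_cvg_mu.
  - by move=> i; exact: measurable_cbox.
  - by rewrite -hbox_bigcup; exact: measurable_hbox.
  - move=> k m km; apply/subsetPset => x hx i; have /andP[-> hi] := hx i.
    move: hi; rewrite !mxE => /le_trans; apply.
    by rewrite lerD2l lerN2 lef_pV2 ?posrE ?ltr0n // ler_nat ltnS.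
rewrite -(cvg_lim _ h) //; apply: cvg_lim => //.
rewrite (_ : _ \o _ = EFin \o (fun k : nat => \prod_(i < d) Num.max (b 0 i - k.+1%:R^-1 - a 0 i)
  0)); last first.
  apply/funext => k /=; rewrite lebmu; congr EFin; apply: eq_bigr => i _; by rewrite !mxE.
apply: cvg_EFin; first by near=> k.
rewrite [X in X x @[x --> _]](_ : _ =
  fun k : nat => \prod_(i < d) Num.max (b 0 i - k.+1%:R^-1 - a 0 i) 0) //.
apply: cvg_big => /=.
  move=> x; apply: (@continuousM _ _ (fst) snd); [exact: cvg_fst|exact: cvg_snd].
move=> i _.
have cm : {for b 0 i - a 0 i, continuous ((id : R -> R^o) \max cst 0)}.
  by apply: continuous_max; [exact: cvg_id|exact: cst_continuous].
apply: (continuous_cvg _ cm).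
apply: cvgB; last exact: cvg_cst.
rewrite -[X in _ --> X]subr0; apply: cvgB; first exact: cvg_cst.
exact: cvg_harmonic.
Unshelve. all: by end_near. Qed.

(* The coefficients of [n] are determined one at a time, in the order of [r]. *)
Lemma fundom_triangular A (r : 'I_d -> nat) : injective r ->
  (forall i j, (r j < r i)%N -> A i j = 0) -> (forall i, A i i != 0) ->
  fundom A (hbox 0 (\row_i `|A i i|)).
Proof.
move=> rI Atri Adiag; split; first exact: measurable_hbox.
- move=> x.
  suff step k : exists n, forall j, (r j < k)%N ->
      0 <= (x + intv n *m A) 0 j < `|A j j|.
    have [n hn] := step (\max_j r j).+1; exists n => j; rewrite [X in X <= _]mxE [X in _ < X]mxE.
    by apply: hn; rewrite ltnS; exact: (@leq_bigmax _ r j).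
  elim: k => [|k [n hn]]; first by exists 0.
  case: (pickP (fun j => r j == k)) => [j /eqP rj|nj]; last first.
    exists n => j; rewrite ltnS leq_eqVlt => /orP[|]; last exact: hn.
    by rewrite nj.
  have [t ht] : exists t : int, 0 <= (x + intv n *m A) 0 j + t%:~R * A j j < `|A j j|.
    set y := (x + _) 0 j; have a0 : 0 < `|A j j| by rewrite normr_gt0.
    have /andP[h1 h2] := floor_itv (y / `|A j j|).
    (* Division with remainder by [|A j j|]; the factor [sgz] makes up for a negative diagonal
       entry. *)
    exists (- (Num.floor (y / `|A j j|) * sgz (A j j))).
    have -> : (- (Num.floor (y / `|A j j|) * sgz (A j j)))%:~R * A j j =
        - ((Num.floor (y / `|A j j|))%:~R * `|A j j|).
      by rewrite mulrNz intrM mulNr -mulrA -sgrEz (normrEsg (A j j)).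
    move: h1 h2; rewrite ler_pdivlMr // ltr_pdivrMr // intrD mulrDl mul1r subr_ge0 => -> /=.
    by rewrite ltrBlDl.
  exists (n + t *: delta_mx 0 j) => i; rewrite ltnS leq_eqVlt.
  have nA : (x + intv (n + t *: delta_mx 0 j) *m A) 0 i =
      (x + intv n *m A) 0 i + t%:~R * A j i.
    rewrite intvD mulmxDl addrA mxE; congr (_ + _).
    rewrite mxE (bigD1 j) //= big1 ?addr0 => [|k' k'j]; first by rewrite !mxE !eqxx mulr1.
    by rewrite !mxE (negbTE k'j) andbF mulr0 mul0r.
  case/orP => [/eqP ri|ri].
    by rewrite nA (rI i j) // ri rj.
  by rewrite nA Atri ?mulr0 ?addr0 ?rj //; exact: hn.
(* Strong induction on the rank: the coefficients of smaller rank vanish, so the two points differ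
   in coordinate [j] by an integer multiple of [A j j] that is smaller than [|A j j|]. *)
- move=> x n hx hxn; apply/rowP => j; rewrite mxE.
  have [k] := ubnP (r j); elim: k j => // k IH j; rewrite ltnS => rjk.
  have nAj : (x + intv n *m A) 0 j = x 0 j + (n 0 j)%:~R * A j j.
    rewrite mxE; congr (_ + _); rewrite mxE (bigD1 j) //= big1 ?addr0 ?mxE // => i ij.
    rewrite mxE; have [h|h|h] := ltngtP (r i) (r j).
    - by rewrite IH ?mul0r // (leq_trans h).
    - by rewrite Atri ?mulr0.
    - by rewrite (rI _ _ h) eqxx in ij.
  have := hxn j; rewrite nAj; have := hx j; rewrite !mxE => /andP[x0 x1] /andP[y0 y1].
  have : `|(n 0 j)%:~R * A j j| < `|A j j| by rewrite ltr_norml; apply/andP; split; lra.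
  rewrite normrM gtr_pMl ?normr_gt0 // -intr_norm ltrz1 => h.
  by apply/eqP; rewrite -normr_eq0; move: h (normr_ge0 (n 0 j)); lia.
Qed.

Lemma lup_decomposition (F : fieldType) m (A : 'M[F]_m) : exists (s : {perm 'I_m}) (L U : 'M[F]_m),
  [/\ perm_mx s *m A = L *m U, forall i j : 'I_m, (i <= j)%N -> L i j = (i == j)%:R
    & forall i j : 'I_m, (j < i)%N -> U i j = 0].
Proof.
case: m A => [|m] A.
  by exists 1%g, 0, 0; split; [rewrite [LHS]flatmx0 [RHS]flatmx0|case|case].
have := cormen_lup_correct A; have := cormen_lup_perm A.
have := cormen_lup_lower A; have := cormen_lup_upper A.
case: cormen_lup => [[P L] U] /= hU hL /is_perm_mxP [s ->] h.
by exists s, L, U; split.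
Qed.

(** Permuting the rows of [A] only relabels the integer coefficients; the lattice is the same. *)
Lemma fundom_perm A D (s : {perm 'I_d}) : fundom (perm_mx s *m A) D -> fundom A D.
Proof.
have pE (t : {perm 'I_d}) n : intv n *m perm_mx t = intv (n *m perm_mx t) :> 'rV[R]_d.
  by rewrite /intv map_mxM map_perm_mx.
move=> [mD ex un]; split => //.
- move=> x; have [n Dn] := ex x; exists (n *m perm_mx s).
  by rewrite -pE -mulmxA.
- move=> x n Dx Dxn.
  have : n *m perm_mx s^-1%g = 0.
    apply: (un x) => //; rewrite -pE -mulmxA [X in _ *m X]mulmxA -perm_mxM mulVg.
    by rewrite perm_mx1 mul1mx.
  move/(congr1 (fun v => v *m perm_mx s)).
  by rewrite -mulmxA -perm_mxM mulVg perm_mx1 mulmx1 mul0mx.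
Qed.

(* For [A = L U] (up to a permutation of the rows) the unit cube is a fundamental
   domain of [L], and a box one of [U]; comparing fundamental domains of [L U]
   and of [U] reduces the volume of [D] to that of the box. *)
Lemma fundom_measure A D : A \in unitmx -> fundom A D -> mu D = (`|\det A|)%:E.
Proof.
move=> uA fD; have [s [L [U [e hL hU]]]] := lup_decomposition A.
have detU : \det U = \prod_i U i i.
  rewrite -det_tr det_trig; first by apply: eq_bigr => i _; rewrite mxE.
  by apply/is_trig_mxP => i j ij; rewrite mxE hU.
have detL : \det L = 1.
  rewrite det_trig; first by rewrite big1 // => i _; rewrite hL // eqxx.
  by apply/is_trig_mxP => i j ij; rewrite hL ?(ltnW ij) // -val_eqE /= ltn_eqF.
have detA : `|\det A| = \prod_i `|U i i|.
  rewrite -normr_prod -detU -[\det U]mul1r -detL -det_mulmx -e det_mulmx det_perm.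
  by rewrite normrM normrX normrN1 expr1n mul1r.
have Udiag i : U i i != 0.
  have : `|\det A| != 0 by rewrite normr_eq0 -unitfE -unitmxE.
  by rewrite detA; apply: contraNneq => h; rewrite (bigD1 i) //= h normr0 mul0r.
have uU : U \in unitmx by rewrite unitmxE unitfE detU; apply/prodf_neq0 => i _.
pose Q := hbox 0 (\row_(i < d) 1 : 'rV[R]_d).
have f1 : fundom 1%:M Q.
  have := @fundom_triangular 1%:M (@nat_of_ord d) (@ord_inj _).
  rewrite /Q (_ : \row_i `|1%:M i i| = \row_(i < d) 1); last first.
    by apply/rowP => i; rewrite !mxE eqxx normr1.
  apply => [i j ji|i]; rewrite mxE; last by rewrite eqxx oner_neq0.
  by rewrite -val_eqE /= gtn_eqF.
(* [L] is lower triangular, so coefficients are determined from the last to the first, whence the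
   rank [d - i]. *)
have fL : fundom L Q.
  have := @fundom_triangular L (fun i : 'I_d => d - i)%N.
  rewrite /Q (_ : \row_i `|L i i| = \row_(i < d) 1); last first.
    by apply/rowP => i; rewrite !mxE hL // eqxx normr1.
  apply => [i j /= h|i j h|i]; last by rewrite hL // eqxx oner_neq0.
    by apply: ord_inj; have := ltn_ord i; have := ltn_ord j; lia.
  have ij : (i < j)%N by have := ltn_ord i; have := ltn_ord j; lia.
  by rewrite hL ?(ltnW ij) // -val_eqE /= ltn_eqF.
have fLU := fundom_mulmx fL uU; rewrite -e in fLU.
rewrite (fundom_mu fD (fundom_perm fLU)).
have := fundom_mulmx f1 uU; rewrite mul1mx => fU.
rewrite (fundom_mu fU (fundom_triangular (@ord_inj d) hU Udiag)) mu_hbox detA; congr EFin.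
by apply: eq_bigr => i _; rewrite !mxE subr0; apply/max_idPl.
Qed.

Lemma fundom_exists A : A \in unitmx -> exists D, fundom A D.
Proof.
move=> uA; pose Q := hbox 0 (\row_(i < d) `|1%:M i i| : 'rV[R]_d).
have f1 : fundom 1%:M Q.
  apply: (@fundom_triangular 1%:M (@nat_of_ord d) (@ord_inj _)) => [i j ji|i].
    by rewrite mxE -val_eqE /= gtn_eqF.
  by rewrite mxE eqxx oner_neq0.
by have := fundom_mulmx f1 uA; rewrite mul1mx; eexists; eassumption.
Qed.

(** [V] is the union of all lattice translates of [Q]; the points of [D] outside [V] represent
    exactly the orbits that [Q] misses. *)
Lemma packing_fundom A (Q : set T) : A \in unitmx -> measurable Q ->
  (forall (x : 'rV[R]_d) n, Q x -> Q (x + intv n *m A) -> n = 0) ->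
  exists2 D, fundom A D & Q `<=` D.
Proof.
move=> uA mQ Qpack; have [D [mD ex un]] := fundom_exists uA.
pose V := \bigcup_(n in [set: 'rV[int]_d]) translate (intv n *m A) @^-1` Q.
exists (Q `|` (D `\` V)); last by move=> x Qx; left.
have mV : measurable V.
  apply: countable_bigcupT_measurable; first exact: countableP.
  by move=> n; apply: measurable_preimage => //; exact: measurable_translate.
split.
- by apply: measurableU => //; exact: measurableD.
- move=> x; have [[n Qn]|nQ] := pselect (exists n, Q (x + intv n *m A)).
    by exists n; left.
  have [n Dn] := ex x; exists n; right; split => // -[m _ Vm]; apply: nQ.
  by exists (n + m); rewrite intvD mulmxDl addrA.
- move=> x n [Qx|[Dx nVx]] [Qn|[Dn nVn]].
  + exact: Qpack Qx Qn.
  + exfalso; apply: nVn; exists (- n) => //; rewrite /translate /= intvN mulNmx addrK.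
    exact: Qx.
  + by exfalso; apply: nVx; exists n.
  + exact: un Dx Dn.
Qed.

End Lebesgue.
End Lattices.
(** * Square-integrable functions *)

Section ComplexAlgebra.
Context {R : realType}.
Implicit Types z w : R[i].
Local Notation Re := (@complex.Re R).
Local Notation Im := (@complex.Im R).

Lemma ReM z w : Re (z * w) = Re z * Re w - Im z * Im w.
Proof. by case: z w => [a b] [e f]. Qed.
Lemma ImM z w : Im (z * w) = Re z * Im w + Im z * Re w.
Proof. by case: z w => [a b] [e f]. Qed.
Lemma ReD z w : Re (z + w) = Re z + Re w.
Proof. by case: z w => [a b] [e f]. Qed.
Lemma ImD z w : Im (z + w) = Im z + Im w.
Proof. by case: z w => [a b] [e f]. Qed.
Lemma ReN z : Re (- z) = - Re z.
Proof. by case: z. Qed.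
Lemma ImN z : Im (- z) = - Im z.
Proof. by case: z. Qed.
Lemma Re_cconj z : Re (cconj z) = Re z.
Proof. by []. Qed.
Lemma Im_cconj z : Im (cconj z) = - Im z.
Proof. by []. Qed.
Lemma Re_sum (I : Type) (s : seq I) (P : pred I) (F : I -> R[i]) :
  Re (\sum_(i <- s | P i) F i) = \sum_(i <- s | P i) Re (F i).
Proof. by apply: big_morph => // x y; rewrite ReD. Qed.
Lemma Im_sum (I : Type) (s : seq I) (P : pred I) (F : I -> R[i]) :
  Im (\sum_(i <- s | P i) F i) = \sum_(i <- s | P i) Im (F i).
Proof. by apply: big_morph => // x y; rewrite ImD. Qed.

Definition complexE := (ReM, ImM, ReD, ImD, ReN, ImN, Re_cconj, Im_cconj).

Lemma eq_ReIm z w : Re z = Re w -> Im z = Im w -> z = w.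
Proof. by case: z w => [a b] [e f] /= -> ->. Qed.

Lemma cconjD z w : cconj (z + w) = cconj z + cconj w.
Proof. by apply: eq_ReIm; rewrite !complexE // opprD. Qed.
Lemma cconjM z w : cconj (z * w) = cconj z * cconj w.
Proof. by apply: eq_ReIm; rewrite !complexE; ring. Qed.
Lemma cconj_real (a : R) : cconj a%:C = a%:C.
Proof. by apply: eq_ReIm; rewrite !complexE //= oppr0. Qed.
Lemma cconj_sum (I : Type) (s : seq I) (P : pred I) (F : I -> R[i]) :
  cconj (\sum_(i <- s | P i) F i) = \sum_(i <- s | P i) cconj (F i).
Proof. by apply: big_morph => [x y|]; [rewrite cconjD|rewrite (cconj_real 0)]. Qed.

Lemma cnorm2_ge0 z : 0 <= cnorm2 z.
Proof. by rewrite addr_ge0 ?sqr_ge0. Qed.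
Lemma cnorm2M z w : cnorm2 (z * w) = cnorm2 z * cnorm2 w.
Proof. by rewrite /cnorm2 !complexE; ring. Qed.
Lemma cnorm2N z : cnorm2 (- z) = cnorm2 z.
Proof. by rewrite /cnorm2 !complexE !sqrrN. Qed.
Lemma cnorm2_real (a : R) : cnorm2 a%:C = a ^+ 2.
Proof. by rewrite /cnorm2 /= expr0n addr0. Qed.
Lemma cnorm2_0 : cnorm2 (0 : R[i]) = 0.
Proof. by rewrite (cnorm2_real 0) expr0n. Qed.
Lemma mul_cconj z : z * cconj z = (cnorm2 z)%:C.
Proof. by apply: eq_ReIm; rewrite !complexE /cnorm2 /=; ring. Qed.
Lemma cnorm2D_le z w : cnorm2 (z + w) <= 2 * cnorm2 z + 2 * cnorm2 w.
Proof.
rewrite -subr_ge0.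
have -> : 2 * cnorm2 z + 2 * cnorm2 w - cnorm2 (z + w) = cnorm2 (z - w).
  by rewrite /cnorm2 !complexE; ring.
exact: cnorm2_ge0.
Qed.
Lemma cnorm2B_le z w : cnorm2 (z - w) <= 2 * cnorm2 z + 2 * cnorm2 w.
Proof. by rewrite -(cnorm2N w) cnorm2D_le. Qed.

(** Supplies the integrable majorant that makes inner products of square-integrable functions well
    behaved. *)
Lemma normr_Re_mulconj z w : `|Re (z * cconj w)| <= cnorm2 z + cnorm2 w.
Proof.
rewrite !complexE /cnorm2 ler_norml.
have := sqr_ge0 (Re z - Re w); have := sqr_ge0 (Im z - Im w).
have := sqr_ge0 (Re z + Re w); have := sqr_ge0 (Im z + Im w).
have := sqr_ge0 (Re z); have := sqr_ge0 (Im z).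
have := sqr_ge0 (Re w); have := sqr_ge0 (Im w).
by rewrite !sqrrD !sqrrN !mulrN ?mulNr => *; apply/andP; split; nra.
Qed.

Lemma normr_Im_mulconj z w : `|Im (z * cconj w)| <= cnorm2 z + cnorm2 w.
Proof.
(* Multiplying [w] by [i] turns the imaginary part into a real part. *)
have -> : Im (z * cconj w) = Re (z * cconj ('i * w)) by rewrite !complexE /=; ring.
have -> : cnorm2 w = cnorm2 ('i * w) by rewrite cnorm2M /cnorm2 /=; ring.
exact: normr_Re_mulconj.
Qed.

(** Expand [|t z - w|^2 >= 0] and divide by [t]. The free weight [t] lets this play the role of
    Cauchy-Schwarz in [synthesis_bound]. *)
Lemma Re_mulconj_le z w (t : R) : 0 < t ->
  2 * Re (z * cconj w) <= t * cnorm2 z + t^-1 * cnorm2 w.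
Proof.
move=> t0; rewrite -subr_ge0.
have -> : t * cnorm2 z + t^-1 * cnorm2 w - 2 * Re (z * cconj w) =
    t^-1 * cnorm2 (t%:C * z - w).
  by rewrite /cnorm2 !complexE /=; field; rewrite gt_eqF.
by rewrite mulr_ge0 ?invr_ge0 ?(ltW t0) ?cnorm2_ge0.
Qed.

End ComplexAlgebra.
Section SquareIntegrable.
Context {R : realType} {d : nat}.
Notation T := (Rd R d).
Notation V := 'rV[R]_d.
Variable mu : {measure set T -> \bar R}.
Local Notation Re := (@complex.Re R).
Local Notation Im := (@complex.Im R).
Implicit Types (f g h u : V -> R[i]).

Definition cmeasurable f := measurable_fun [set: T] (fun x : T => Re (f x)) /\
  measurable_fun [set: T] (fun x : T => Im (f x)).

Definition rintegrable (f : V -> R) := mu.-integrable [set: T] (fun x : T => (f x)%:E).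

Lemma cmeasurableD f g : cmeasurable f -> cmeasurable g -> cmeasurable (fun x => f x + g x).
Proof.
move=> [f1 f2] [g1 g2]; split.
- by under eq_fun do rewrite ReD; exact: measurable_funD.
- by under eq_fun do rewrite ImD; exact: measurable_funD.
Qed.

Lemma cmeasurableN f : cmeasurable f -> cmeasurable (fun x => - f x).
Proof.
move=> [f1 f2]; split.
- by under eq_fun do rewrite ReN; exact: measurableT_comp.
- by under eq_fun do rewrite ImN; exact: measurableT_comp.
Qed.

Lemma cmeasurable_cst (c : R[i]) : cmeasurable (fun=> c).
Proof. by split; exact: measurable_cst. Qed.

Lemma cmeasurableM f g : cmeasurable f -> cmeasurable g -> cmeasurable (fun x => f x * g x).
Proof.
move=> [f1 f2] [g1 g2]; split.
- under eq_fun do rewrite ReM.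
  by apply: measurable_funB; exact: measurable_funM.
- under eq_fun do rewrite ImM.
  by apply: measurable_funD; exact: measurable_funM.
Qed.

Lemma cmeasurable_conj f : cmeasurable f -> cmeasurable (fun x => cconj (f x)).
Proof. by move=> [f1 f2]; split => //=; exact: measurableT_comp. Qed.

Lemma cmeasurable_real (f : V -> R) :
  measurable_fun [set: T] (f : T -> R) -> cmeasurable (fun x => (f x)%:C).
Proof. by move=> mf; split => //=; exact: measurable_cst. Qed.

Lemma cmeasurable_sum (I : Type) (s : seq I) (F : I -> V -> R[i]) :
  (forall i, cmeasurable (F i)) -> cmeasurable (fun x => \sum_(i <- s) F i x).
Proof.
move=> mF; split.
- by under eq_fun do rewrite Re_sum; apply: measurable_sum => i; have [] := mF i.
- by under eq_fun do rewrite Im_sum; apply: measurable_sum => i; have [] := mF i.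
Qed.

Lemma measurable_cnorm2 f : cmeasurable f -> measurable_fun [set: T] (fun x : T => cnorm2 (f x)).
Proof.
move=> [f1 f2]; apply: measurable_funD; exact: measurable_funX.
Qed.

Lemma L2P f : L2 mu f <-> cmeasurable f /\ rintegrable (fun x => cnorm2 (f x)).
Proof.
split=> [[f1 [f2 f3]]|[[f1 f2] /integrableP[f3 f4]]].
  split=> //; apply/integrableP; split.
    by apply/measurable_EFinP; exact: measurable_cnorm2.
  by under eq_integral => x _ do rewrite gee0_abs ?lee_fin ?cnorm2_ge0 //.
do 2 split => //; move: f4.
by under eq_integral => x _ do rewrite gee0_abs ?lee_fin ?cnorm2_ge0 //.
Qed.

Lemma L2_measurable f : L2 mu f -> cmeasurable f.
Proof. by case/L2P. Qed.

Lemma rintegrable_le (f : V -> R) (g : V -> R) :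
  measurable_fun [set: T] (f : T -> R) -> (forall x,
    `|f x| <= g x) -> rintegrable g -> rintegrable f.
Proof.
move=> mf fg; apply: le_integrable => //; first exact/measurable_EFinP.
by move=> x _ /=; rewrite lee_fin (le_trans (fg x)) // ler_norm.
Qed.

Lemma L2_le f (phi : V -> R) : cmeasurable f -> rintegrable phi ->
  (forall x, cnorm2 (f x) <= phi x) -> L2 mu f.
Proof.
move=> mf iphi fphi; apply/L2P; split => //.
apply: (rintegrable_le _ _ iphi); first exact: measurable_cnorm2.
by move=> x; rewrite ger0_norm ?cnorm2_ge0.
Qed.

Lemma rintegrableZ (c : R) (f : V -> R) : rintegrable f -> rintegrable (fun x => c * f x).
Proof. by move=> /(@integrableZl _ _ _ _ _ measurableT c). Qed.

Lemma rintegrableD (f g : V -> R) : rintegrable f -> rintegrable g ->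
  rintegrable (fun x => f x + g x).
Proof. by move=> hf hg; apply: eq_integrable (integrableD measurableT hf hg). Qed.

Lemma L2_cnorm2 f : L2 mu f -> rintegrable (fun x => cnorm2 (f x)).
Proof. by case/L2P. Qed.

Lemma L2D f g : L2 mu f -> L2 mu g -> L2 mu (fun x => f x + g x).
Proof.
move=> Lf Lg; apply: (@L2_le _ (fun x => 2 * cnorm2 (f x) + 2 * cnorm2 (g x))).
- by apply: cmeasurableD; exact: L2_measurable.
- by apply: rintegrableD; apply: rintegrableZ; exact: L2_cnorm2.
- by move=> x; exact: cnorm2D_le.
Qed.

Lemma L2M_bounded u f (C : R) : cmeasurable u -> (forall x, cnorm2 (u x) <= C) ->
  L2 mu f -> L2 mu (fun x => u x * f x).
Proof.
move=> mu_ uC Lf; apply: (@L2_le _ (fun x => C * cnorm2 (f x))).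
- by apply: cmeasurableM => //; exact: L2_measurable.
- by apply: rintegrableZ; exact: L2_cnorm2.
- by move=> x; rewrite cnorm2M ler_wpM2r ?cnorm2_ge0.
Qed.

Lemma L2Z (c : R[i]) f : L2 mu f -> L2 mu (fun x => c * f x).
Proof. by apply: (@L2M_bounded (fun=> c) f (cnorm2 c)) => //; exact: cmeasurable_cst. Qed.

Lemma L2N f : L2 mu f -> L2 mu (fun x => - f x).
Proof. by move=> /(L2Z (-1)); under eq_fun do rewrite mulN1r. Qed.

Lemma L2B f g : L2 mu f -> L2 mu g -> L2 mu (fun x => f x - g x).
Proof. by move=> Lf /L2N; exact: L2D. Qed.

Lemma L2_0 : L2 mu (fun=> 0).
Proof.
apply/L2P; split; first exact: cmeasurable_cst.
by rewrite /rintegrable; under eq_fun do rewrite cnorm2_0; exact: integrable0.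
Qed.

Lemma L2_sum (I : Type) (s : seq I) (F : I -> V -> R[i]) :
  (forall i, L2 mu (F i)) -> L2 mu (fun x => \sum_(i <- s) F i x).
Proof.
move=> LF; elim: s => [|i s IH]; first by under eq_fun do rewrite big_nil; exact: L2_0.
by under eq_fun do rewrite big_cons; exact: L2D.
Qed.

(** The squared norm. Sums are estimated through [|z + w|^2 <= 2 |z|^2 + 2 |w|^2] instead of the
    triangle inequality, which is the origin of the factors 2, 4 and 8 below. *)
Definition n2 f := Rintegral mu [set: T] (fun x : T => cnorm2 (f x)).

Lemma n2_ge0 f : 0 <= n2 f.
Proof. by apply: Rintegral_ge0 => x _; exact: cnorm2_ge0. Qed.

Lemma sqr_L2norm f : L2norm mu f ^+ 2 = n2 f.
Proof. by rewrite /L2norm sqr_sqrtr // n2_ge0. Qed.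

Lemma n2_le f (phi : V -> R) : L2 mu f -> rintegrable phi ->
  (forall x, cnorm2 (f x) <= phi x) -> n2 f <= Rintegral mu [set: T] (phi : T -> R).
Proof. by move=> Lf iphi fphi; apply: le_Rintegral => //; exact: L2_cnorm2. Qed.

Lemma n2_leM f g (C : R) : L2 mu f -> L2 mu g ->
  (forall x, cnorm2 (f x) <= C * cnorm2 (g x)) -> n2 f <= C * n2 g.
Proof.
move=> Lf Lg fg; rewrite -[C * n2 g]RintegralZl //; last exact: L2_cnorm2.
apply: n2_le => //; apply: rintegrableZ; exact: L2_cnorm2.
Qed.

Lemma n2D_le f g : L2 mu f -> L2 mu g -> n2 (fun x => f x + g x) <= 2 * n2 f + 2 * n2 g.
Proof.
move=> Lf Lg; have f2 := L2_cnorm2 Lf; have g2 := L2_cnorm2 Lg.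
rewrite -[2 * n2 f]RintegralZl // -[2 * n2 g]RintegralZl //.
rewrite -RintegralD //; try exact: rintegrableZ.
apply: n2_le; first exact: L2D.
  by apply: rintegrableD; exact: rintegrableZ.
by move=> x; exact: cnorm2D_le.
Qed.

Lemma n2N f : n2 (fun x => - f x) = n2 f.
Proof. by apply: eq_Rintegral => x _; rewrite cnorm2N. Qed.

Lemma n2B_le f g : L2 mu f -> L2 mu g -> n2 (fun x => f x - g x) <= 2 * n2 f + 2 * n2 g.
Proof. by move=> Lf Lg; rewrite -(n2N g); apply: n2D_le => //; exact: L2N. Qed.

(** The exponential constant is harmless: where it is applied, the number of summands is fixed
    before the precision is chosen. *)
Lemma n2_sum_le (I : Type) (s : seq I) (F : I -> V -> R[i]) : (forall i, L2 mu (F i)) ->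
  n2 (fun x => \sum_(i <- s) F i x) <= 2 ^+ size s * \sum_(i <- s) n2 (F i).
Proof.
move=> LF; elim: s => [|i s IH].
  rewrite big_nil mulr0 /n2; under eq_Rintegral do rewrite big_nil cnorm2_0.
  by rewrite Rintegral_cst // mul0r.
rewrite [X in n2 X](_ : _ = fun x => F i x + \sum_(j <- s) F j x); last first.
  by apply/funext => x; rewrite big_cons.
apply: le_trans (n2D_le (LF i) (L2_sum s LF)) _.
rewrite big_cons mulrDr lerD //=.
  rewrite ler_wpM2r ?n2_ge0 // exprS ler_peMr // -[X in X <= _](expr1n _ (size s)).
  by rewrite lerXn2r ?nnegrE ?ler1n.
by rewrite exprS -mulrA ler_wpM2l.
Qed.

Lemma rintegrable_Re_mulconj f g : L2 mu f -> L2 mu g ->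
  rintegrable (fun x => Re (f x * cconj (g x))).
Proof.
move=> Lf Lg; apply: (rintegrable_le _ (fun x => normr_Re_mulconj (f x) (g x))).
  have [] // := cmeasurableM (L2_measurable Lf) (cmeasurable_conj (L2_measurable Lg)).
by apply: rintegrableD; exact: L2_cnorm2.
Qed.

Lemma rintegrable_Im_mulconj f g : L2 mu f -> L2 mu g ->
  rintegrable (fun x => Im (f x * cconj (g x))).
Proof.
move=> Lf Lg; apply: (rintegrable_le _ (fun x => normr_Im_mulconj (f x) (g x))).
  have [] // := cmeasurableM (L2_measurable Lf) (cmeasurable_conj (L2_measurable Lg)).
by apply: rintegrableD; exact: L2_cnorm2.
Qed.

Lemma innerC f g : L2 mu f -> L2 mu g -> inner mu g f = cconj (inner mu f g).
Proof.
move=> Lf Lg; apply: eq_ReIm; rewrite /inner /=.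
  by apply: eq_Rintegral => x _; rewrite !complexE; ring.
rewrite -mulN1r -RintegralZl //; last exact: rintegrable_Im_mulconj.
by apply: eq_Rintegral => x _; rewrite !complexE; ring.
Qed.

Lemma innerDl f g u : L2 mu f -> L2 mu g -> L2 mu u ->
  inner mu (fun x => f x + g x) u = inner mu f u + inner mu g u.
Proof.
move=> Lf Lg Lu; apply: eq_ReIm; rewrite ?ReD ?ImD /inner /= -RintegralD //.
- by apply: eq_Rintegral => x _; rewrite mulrDl ReD.
- exact: rintegrable_Re_mulconj.
- exact: rintegrable_Re_mulconj.
- by apply: eq_Rintegral => x _; rewrite mulrDl ImD.
- exact: rintegrable_Im_mulconj.
- exact: rintegrable_Im_mulconj.
Qed.

Lemma innerZl (c : R[i]) f u : L2 mu f -> L2 mu u ->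
  inner mu (fun x => c * f x) u = c * inner mu f u.
Proof.
move=> Lf Lu; have iRe := rintegrable_Re_mulconj Lf Lu.
have iIm := rintegrable_Im_mulconj Lf Lu.
have Z (a : R) (h : V -> R) : rintegrable h -> mu.-integrable [set: T] (EFin \o (fun x : T => a *
  h x)).
  exact: rintegrableZ.
apply: eq_ReIm; rewrite ?ReM ?ImM /inner /= -!RintegralZl //.
- rewrite -RintegralB //; try exact: Z.
  by apply: eq_Rintegral => x _; rewrite -mulrA ReM.
- rewrite -RintegralD //; try exact: Z.
  by apply: eq_Rintegral => x _; rewrite -mulrA ImM.
Qed.

Lemma innerNl f u : L2 mu f -> L2 mu u -> inner mu (fun x => - f x) u = - inner mu f u.
Proof.
move=> Lf Lu; rewrite -[RHS]mulN1r -innerZl //.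
by under [in RHS]eq_fun do rewrite mulN1r.
Qed.

Lemma innerBl f g u : L2 mu f -> L2 mu g -> L2 mu u ->
  inner mu (fun x => f x - g x) u = inner mu f u - inner mu g u.
Proof. by move=> Lf Lg Lu; rewrite innerDl // ?innerNl //; exact: L2N. Qed.

Lemma inner0l u : inner mu (fun=> 0) u = 0.
Proof.
have z : Rintegral mu [set: T] (fun=> 0 : R) = 0 by rewrite Rintegral_cst // mul0r.
by apply: eq_ReIm; rewrite -[RHS]z; apply: eq_Rintegral => x _; rewrite mul0r.
Qed.

Lemma inner_suml (I : Type) (s : seq I) (F : I -> V -> R[i]) u :
  (forall i, L2 mu (F i)) -> L2 mu u ->
  inner mu (fun x => \sum_(i <- s) F i x) u = \sum_(i <- s) inner mu (F i) u.
Proof.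
move=> LF Lu; elim: s => [|i s IH].
  by rewrite big_nil -[RHS](inner0l u); under eq_fun do rewrite big_nil.
rewrite big_cons -IH -innerDl //; last exact: L2_sum.
by congr (inner mu _ u); apply/funext => x; rewrite big_cons.
Qed.

Lemma innerZr (c : R[i]) f u : L2 mu f -> L2 mu u ->
  inner mu u (fun x => c * f x) = cconj c * inner mu u f.
Proof.
move=> Lf Lu; rewrite innerC //; last exact: L2Z.
by rewrite innerZl // cconjM -innerC.
Qed.

Lemma inner_sumr (I : Type) (s : seq I) (F : I -> V -> R[i]) u :
  (forall i, L2 mu (F i)) -> L2 mu u ->
  inner mu u (fun x => \sum_(i <- s) F i x) = \sum_(i <- s) inner mu u (F i).
Proof.
move=> LF Lu; rewrite innerC //; last exact: L2_sum.
by rewrite inner_suml // cconj_sum; apply: eq_bigr => i _; rewrite -innerC.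
Qed.

Lemma inner_self f : inner mu f f = (n2 f)%:C.
Proof.
apply: eq_ReIm => /=; first by apply: eq_Rintegral => x _; rewrite mul_cconj.
under eq_Rintegral do rewrite mul_cconj /=.
by rewrite Rintegral_cst // mul0r.
Qed.

Lemma n2D_orthogonal f g : L2 mu f -> L2 mu g -> inner mu f g = 0 ->
  n2 (fun x => f x + g x) = n2 f + n2 g.
Proof.
move=> Lf Lg fg0; have [f2 g2] := (L2_cnorm2 Lf, L2_cnorm2 Lg).
have ifg := rintegrable_Re_mulconj Lf Lg.
have : Rintegral mu [set: T] (fun x : T => 2 * Re (f x * cconj (g x))) = 0.
  by rewrite RintegralZl // -[Rintegral _ _ _]/(Re (inner mu f g)) fg0 mulr0.
rewrite -[n2 f + _]addr0 => <-; rewrite /n2 -RintegralD // -RintegralD //.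
- by apply: eq_Rintegral => x _; rewrite /cnorm2 !complexE; ring.
- exact: rintegrableD.
- exact: rintegrableZ.
Qed.

(** Dominated convergence, in the form of one good index for each [eps]. *)
Lemma n2_cvg0 (F : nat -> V -> R[i]) (phi : V -> R) :
  (forall n, L2 mu (F n)) -> rintegrable phi -> (forall n x, cnorm2 (F n x) <= phi x) ->
  (forall x, cnorm2 (F n x) @[n --> \oo] --> 0) ->
  forall eps : R, 0 < eps -> exists n, n2 (F n) < eps.
Proof.
move=> LF iphi Fphi F0 eps eps0.
have h : (\int[mu]_x (cnorm2 (F n x))%:E)%E @[n --> \oo] --> (\int[mu]_(x in [set: T]) (cst 0 x))%E.
  apply: (@dominated_cvg _ T _ mu [set: T] measurableT (fun n (x : T) => (cnorm2 (F n x))%:E) _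
     (fun x : T => (phi x)%:E)) => //.
  - by move=> n; apply/measurable_EFinP; apply: measurable_cnorm2; exact: L2_measurable.
  - by move=> x _; apply: cvg_EFin; [near=> n|exact: F0].
  - by move=> n x _; rewrite gee0_abs ?lee_fin ?cnorm2_ge0.
rewrite integral0 in h.
have /fine_cvgP[_ h1] := h.
have /cvgrPdist_lt /(_ _ eps0) [n _ hn] := h1.
exists n; have := hn n (leqnn n).
by rewrite /= sub0r normrN ger0_norm //; exact: n2_ge0.
Unshelve. all: by end_near. Qed.

(** * Orthogonal systems: projection and Bessel's inequality *)

Section Orthogonal.
Variables (I : eqType) (u : I -> V -> R[i]) (kappa : R).
Hypotheses (kappa_gt0 : 0 < kappa) (Lu : forall i, L2 mu (u i))
  (orthu : forall i j, inner mu (u i) (u j) = if i == j then kappa%:C else 0).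

Definition orth_proj (s : seq I) f : V -> R[i] :=
  fun x => \sum_(i <- s) (kappa^-1)%:C * inner mu f (u i) * u i x.

Lemma L2_orth_proj s f : L2 mu (orth_proj s f).
Proof. by apply: L2_sum => i; exact: L2Z. Qed.

Lemma orth_proj_residual s f j : uniq s -> L2 mu f -> j \in s ->
  inner mu (fun x => f x - orth_proj s f x) (u j) = 0.
Proof.
move=> us Lf js; rewrite innerBl //; last exact: L2_orth_proj.
rewrite inner_suml // => [|i]; last exact: L2Z.
rewrite (bigD1_seq j) //= big1 => [|i ij]; last by rewrite innerZl // orthu (negbTE ij) mulr0.
rewrite addr0 innerZl // orthu eqxx mulrAC -rmorphM /= mulVf ?gt_eqF // mul1r subrr //.
Qed.

(** Best approximation: the two errors differ by an element of the span, which is orthogonal to the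
    residual of the projection. The competitor [l] may repeat indices. *)
Lemma n2_orth_proj_residual_le s f (l : seq (R[i] * I)) : uniq s -> L2 mu f ->
  all (fun q => q.2 \in s) l ->
  n2 (fun x => f x - orth_proj s f x) <= n2 (fun x => f x - \sum_(q <- l) q.1 * u q.2 x).
Proof.
move=> us Lf ls; set w := fun x => f x - orth_proj s f x.
have Lw : L2 mu w by apply: L2B => //; exact: L2_orth_proj.
have w0 i : i \in s -> inner mu w (u i) = 0 by exact: orth_proj_residual.
have Ll : L2 mu (fun x => \sum_(q <- l) q.1 * u q.2 x) by apply: L2_sum => q; exact: L2Z.
pose v := fun x => orth_proj s f x - \sum_(q <- l) q.1 * u q.2 x.
have Lv : L2 mu v by apply: L2B => //; exact: L2_orth_proj.
rewrite [X in _ <= n2 X](_ : _ = fun x => w x + v x); last first.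
  by apply/funext => x; rewrite /w /v addrA subrK.
rewrite n2D_orthogonal ?lerDl ?n2_ge0 // innerC // innerBl //; last exact: L2_orth_proj.
rewrite !inner_suml //; try by move=> ?; exact: L2Z.
rewrite !big_seq !big1 ?subr0 ?(cconj_real 0) // => [q ql|i si].
  by rewrite innerZl // (innerC Lw) // w0 ?(cconj_real 0) ?mulr0 //; exact: (allP ls).
by rewrite innerZl // (innerC Lw) // w0 ?(cconj_real 0) ?mulr0.
Qed.

(** Pythagoras for [f] split into residual [w] and projection. As [w] is orthogonal to the
    projection, the squared norm of the projection equals the inner product of [f] with it. *)
Lemma bessel_inequality s f : uniq s -> L2 mu f ->
  \sum_(i <- s) cnorm2 (inner mu f (u i)) <= kappa * n2 f.
Proof.
move=> us Lf; set w := fun x => f x - orth_proj s f x.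
have LP := L2_orth_proj s f.
have Lw : L2 mu w by apply: L2B.
have wP : inner mu w (orth_proj s f) = 0.
  rewrite inner_sumr // => [|i]; last exact: L2Z.
  rewrite big_seq big1 // => i si.
  by rewrite innerZr // orth_proj_residual // mulr0.
have fE : n2 f = n2 w + n2 (orth_proj s f).
  rewrite -n2D_orthogonal //; congr n2; apply/funext => x; by rewrite /w subrK.
have PE : (n2 (orth_proj s f))%:C = (kappa^-1 * \sum_(i <- s) cnorm2 (inner mu f (u i)))%:C.
  rewrite -inner_self -[LHS]add0r -wP -innerDl //.
  rewrite [X in inner mu X _](_ : _ = f); last by apply/funext => x; rewrite /w subrK.
  rewrite inner_sumr // => [|i]; last exact: L2Z.
  rewrite rmorphM rmorph_sum big_distrr /=; apply: eq_bigr => i _.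
  by rewrite innerZr // cconjM cconj_real -mulrA; congr (_ * _); rewrite mulrC mul_cconj.
move/(congr1 Re) : PE => /= PE.
rewrite fE PE mulrDr mulrA mulfV ?gt_eqF // mul1r lerDr.
by rewrite mulr_ge0 ?(ltW kappa_gt0) ?n2_ge0.
Qed.

End Orthogonal.

(** The squared norm of the sum [S] is a sum of products of [<f, H i>] with the conjugate of
    [<S, F i>]. The weight [t = CF] in [Re_mulconj_le] turns the second half into at most [n2 S],
    which is absorbed on the left. The bound does not involve the length of [s]. *)
Lemma synthesis_bound (I : eqType) (F H : I -> V -> R[i]) (CF CH : R) (s : seq I) f :
  0 < CF -> (forall i, L2 mu (F i)) -> (forall i, L2 mu (H i)) -> L2 mu f -> 
  (forall f, L2 mu f -> \sum_(i <- s) cnorm2 (inner mu f (F i)) <= CF * n2 f) ->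
  (forall f, L2 mu f -> \sum_(i <- s) cnorm2 (inner mu f (H i)) <= CH * n2 f) ->
  n2 (fun x => \sum_(i <- s) inner mu f (H i) * F i x) <= CF * CH * n2 f.
Proof.
move=> CF0 LF LH Lf BF BH; set S := fun x => \sum_(i <- s) _.
have LS : L2 mu S by apply: L2_sum => i; exact: L2Z.
have XE : n2 S = \sum_(i <- s) Re (inner mu f (H i) * cconj (inner mu S (F i))).
  rewrite -[LHS]/(Re (n2 S)%:C) -inner_self {1}/S inner_suml // => [|i]; last exact: L2Z.
  by rewrite Re_sum; apply: eq_bigr => i _; rewrite innerZl // -innerC.
have h : 2 * n2 S <= CF * (CH * n2 f) + CF^-1 * (CF * n2 S).
  rewrite {1}XE mulr_sumr.
  apply: le_trans (ler_sum _ (fun i _ => @Re_mulconj_le _ _ _ CF CF0)) _.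
  rewrite big_split /= -!mulr_sumr lerD // ler_wpM2l ?invr_ge0 ?(ltW CF0) //.
    exact: BH.
  exact: BF.
rewrite mulKf ?gt_eqF // in h; lra.
Qed.

End SquareIntegrable.

(** * The exponential [e2pi] *)

Section ExpTwoPi.
Context {R : realType}.
Implicit Types t : R.
Local Notation Re := (@complex.Re R).
Local Notation Im := (@complex.Im R).

Lemma e2piD s t : e2pi (s + t) = e2pi s * e2pi t :> R[i].
Proof. by rewrite /e2pi mulrDr cosD sinD; apply: eq_ReIm; rewrite !complexE /=; ring. Qed.

Lemma e2pi0 : e2pi 0 = 1 :> R[i].
Proof. by rewrite /e2pi mulr0 cos0 sin0. Qed.

Lemma e2piN t : e2pi (- t) = cconj (e2pi t) :> R[i].
Proof. by rewrite /e2pi mulrN cosN sinN. Qed.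

Lemma cnorm2_e2pi t : cnorm2 (e2pi t) = 1.
Proof. by rewrite /cnorm2 /= cos2Dsin2. Qed.

Lemma e2pi_half : e2pi (2^-1) = -1 :> R[i].
Proof.
rewrite /e2pi mulrAC mulfV ?pnatr_eq0 // mul1r cospi sinpi.
by apply: eq_ReIm; rewrite !complexE //= oppr0.
Qed.

Lemma e2pi1 : e2pi 1 = 1 :> R[i].
Proof. by rewrite (splitr 1) e2piD mul1r e2pi_half mulrNN mulr1. Qed.

Lemma e2pi_nat (n : nat) : e2pi n%:R = 1 :> R[i].
Proof.
elim: n => [|n IH]; first exact: e2pi0.
by rewrite -natr1 e2piD IH e2pi1 mulr1.
Qed.

Lemma e2pi_int (n : int) : e2pi n%:~R = 1 :> R[i].
Proof.
case: n => n; first exact: e2pi_nat.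
by rewrite NegzE mulrNz e2piN -pmulrn e2pi_nat (cconj_real 1).
Qed.

Lemma e2pi_sum (I : Type) (s : seq I) (P : pred I) (F : I -> R) :
  e2pi (\sum_(i <- s | P i) F i) = \prod_(i <- s | P i) e2pi (F i) :> R[i].
Proof. by apply: (big_morph (fun t : R => e2pi t)) => [x y|]; [exact: e2piD|exact: e2pi0]. Qed.

End ExpTwoPi.

(** * Polynomials converging to a step function *)

Section Threshold.
Context {R : realType}.
Implicit Types a r t : R.

Lemma bernoulli_le a n : -1 <= a -> 1 + n%:R * a <= (1 + a) ^+ n.
Proof.
move=> a1; elim: n => [|n IH]; first by rewrite mul0r addr0 expr0.
rewrite exprS -natr1; apply: le_trans (ler_wpM2l _ IH); last by rewrite -lerBlDl sub0r.
have : 0 <= n%:R * a ^+ 2 by rewrite mulr_ge0 ?sqr_ge0.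
by rewrite expr2; lra.
Qed.

(** By Bernoulli the product is at most [((1 - a) (1 + a))^n = (1 - a^2)^n]. It is used as the upper
    bound [1 / (1 + n a)] for [(1 - a)^n]. *)
Lemma exp_mul_le1 a n : 0 <= a <= 1 -> (1 - a) ^+ n * (1 + n%:R * a) <= 1.
Proof.
move=> /andP[a0 a1].
apply: (@le_trans _ _ ((1 - a) ^+ n * (1 + a) ^+ n)).
  by rewrite ler_wpM2l ?exprn_ge0 ?subr_ge0 // bernoulli_le //; lra.
by rewrite -exprMn -subr_sqr expr1n exprn_ile1 ?lerBlDr ?subr_ge0 ?lerDl ?sqr_ge0 // expr_le1.
Qed.

Lemma cvg_natr_exp r : 0 <= r < 1 -> n%:R * r ^+ n @[n --> \oo] --> 0.
Proof.
(* In [r^n = q^n q^n] one factor [q^n] absorbs [n] through [exp_mul_le1]; the other tends to 0. *)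
move=> /andP[r0 r1]; set q := Num.sqrt r.
have q0 : 0 <= q by exact: sqrtr_ge0.
have qE : q ^+ 2 = r by rewrite sqr_sqrtr.
have q1 : q < 1 by rewrite -(expr_lt1 (n := 2)) // qE.
have bound n : n%:R * r ^+ n <= (1 - q)^-1 * q ^+ n.
  rewrite mulrC ler_pdivlMl ?subr_gt0 // -qE -exprM mulnC exprM expr2 mulrA mulrA.
  have := @exp_mul_le1 (1 - q) n; rewrite subr_ge0 (ltW q1) lerBlDl lerDr q0 => /(_ isT).
  rewrite subKr mulrDr mulr1 => h.
  have := exprn_ge0 n q0 => h'.
  rewrite -[X in _ <= X]mul1r mulrAC ler_wpM2r //; lra.
apply: (@squeeze_cvgr _ _ _ _ (fun=> 0) (fun n => (1 - q)^-1 * q ^+ n)).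
- by near=> n; rewrite bound mulr_ge0 ?exprn_ge0.
- exact: cvg_cst.
- rewrite -[X in _ --> X](mulr0 (1 - q)^-1); apply: cvgM; first exact: cvg_cst.
  by apply: cvg_expr; rewrite ger0_norm.
Unshelve. all: by end_near. Qed.

(* At the critical value [t = 1/2] the factor [n] in the exponent forces the
   limit 0, so the convergence is pointwise everywhere. *)
Definition threshold (n : nat) t : R := (1 - t ^+ n) ^+ (n * 2 ^ n).

Lemma threshold_itv n t : 0 <= t <= 1 -> 0 <= threshold n t <= 1.
Proof.
move=> /andP[t0 t1]; have h0 : 0 <= t ^+ n by exact: exprn_ge0.
have h1 : t ^+ n <= 1 by exact: exprn_ile1.
by rewrite exprn_ge0 ?exprn_ile1 //; lra.
Qed.

(** The exponent is made so that [n 2^n t^n = n (2t)^n]. Below 1/2 Bernoulli gives the lower bound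
    [1 - n (2t)^n]; from 1/2 on [exp_mul_le1] gives the upper bound
    [1 / (1 + n (2t)^n) <= 1 / (n + 1)]. *)
Lemma threshold_cvg t : 0 <= t <= 1 ->
  threshold n t @[n --> \oo] --> (if t < 2^-1 then 1 else 0 : R).
Proof.
move=> /andP[t0 t1]; have a01 n : 0 <= t ^+ n <= 1 by rewrite exprn_ge0 ?exprn_ile1.
have kE n : (n * 2 ^ n)%:R * t ^+ n = n%:R * (2 * t) ^+ n.
  by rewrite natrM natrX exprMn mulrA.
case: ltP => ht.
  apply: (@squeeze_cvgr _ _ _ _ (fun n => 1 - n%:R * (2 * t) ^+ n) (fun=> 1)).
  - near=> n; have /andP[_ ->] := threshold_itv n (introT andP (conj t0 t1)).
    rewrite andbT; have := @bernoulli_le (- t ^+ n) (n * 2 ^ n).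
    by rewrite lerN2; have /andP[_ ->] := a01 n; rewrite mulrN kE; apply.
  - rewrite -[X in _ --> X]subr0; apply: cvgB; first exact: cvg_cst.
    by apply: cvg_natr_exp; apply/andP; split; lra.
  - exact: cvg_cst.
apply: (@squeeze_cvgr _ _ _ _ (fun=> 0) (fun n => n.+1%:R^-1)).
- near=> n; have /andP[-> _] := threshold_itv n (introT andP (conj t0 t1)) => /=.
  rewrite -[_^-1]mul1r ler_pdivlMr ?ltr0n //.
  apply: le_trans (exp_mul_le1 (n * 2 ^ n) (a01 n)).
  have /andP[h0 _] := threshold_itv n (introT andP (conj t0 t1)).
  rewrite ler_wpM2l // kE -natr1 addrC lerD2l -[X in X <= _]mulr1 ler_wpM2l //.
  by apply: exprn_ege1; lra.
- exact: cvg_cst.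
- exact: cvg_harmonic.
Unshelve. all: by end_near. Qed.

Lemma cvg_cnorm2_real (u : nat -> R) (l : R) :
  u n @[n --> \oo] --> l -> cnorm2 (l%:C - (u n)%:C) @[n --> \oo] --> 0.
Proof.
move=> ul; rewrite (_ : (fun n => _) = fun n => (l - u n) * (l - u n)); last first.
  by apply/funext => n; rewrite -rmorphB cnorm2_real expr2.
have h0 : l - u n @[n --> \oo] --> 0.
  by rewrite -[X in _ --> X](subrr l); apply: cvgB => //; exact: cvg_cst.
by rewrite -[X in _ --> X](mulr0 0); exact: cvgM.
Qed.

End Threshold.

(** * Fractional parts read off sine and cosine *)

Section FractionalPart.
Context {R : realType}.
Implicit Types y b : R.

Definition frac y : R := y - (Num.floor y)%:~R.

Lemma frac_itv y : 0 <= frac y < 1.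
Proof. by have := floor_itv y; rewrite intrD => /andP[? ?]; apply/andP; rewrite /frac; split;
  lra. Qed.

Lemma e2pi_frac y : e2pi (frac y) = e2pi y.
Proof. by rewrite /frac e2piD e2piN e2pi_int (cconj_real 1) mulr1. Qed.

Lemma sin_ge0_frac y : (0 <= sin (2 * pi * frac y)) = (frac y <= 2^-1).
Proof.
have /andP[u0 u1] := frac_itv y; have pi0 := pi_gt0 R; set u := frac y in u0 u1 *.
case: (leP u 2^-1) => hu; first by apply: sin_ge0_pi; apply/andP; split; nra.
apply/negbTE; rewrite -ltNge -[_ * u](subrK pi) sinDpi oppr_lt0.
by apply: sin_gt0_pi; apply/andP; split; nra.
Qed.

(** The sign of the sine tells in which half of the period [y] lies, and on the first half the
    cosine is strictly decreasing. *)
Lemma frac_lt_cos_le y b : 0 < b <= 2^-1 ->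
  (frac y < b) = (0 <= sin (2 * pi * y)) && (cos (2 * pi * b) < cos (2 * pi * y)).
Proof.
move=> /andP[b0 b1].
have /(congr1 (@complex.Re R)) /= <- := e2pi_frac y;
  have /(congr1 (@complex.Im R)) /= <- := e2pi_frac y.
rewrite sin_ge0_frac; have /andP[u0 u1] := frac_itv y; have pi0 := pi_gt0 R.
set u := frac y in u0 u1 *.
case: (leP u 2^-1) => hu /=; last by apply/negbTE; rewrite -leNgt; lra.
rewrite ltr_cos ?in_itv /=; [|apply/andP; split; nra|apply/andP; split; nra].
by rewrite ltr_pM2l //; nra.
Qed.

(** Here all of the first half qualifies; on the second half the reflection [v -> 1 - v] brings the
    cosine back to its decreasing range. *)
Lemma frac_lt_cos_gt y b : 2^-1 < b <= 1 ->
  (frac y < b) = (0 <= sin (2 * pi * y)) || (cos (2 * pi * y) < cos (2 * pi * b)).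
Proof.
move=> /andP[b0 b1].
have /(congr1 (@complex.Re R)) /= <- := e2pi_frac y;
  have /(congr1 (@complex.Im R)) /= <- := e2pi_frac y.
rewrite sin_ge0_frac; have /andP[u0 u1] := frac_itv y; have pi0 := pi_gt0 R.
set u := frac y in u0 u1 *.
case: (leP u 2^-1) => hu /=; first by lra.
have cosE (v : R) : cos (2 * pi * v) = cos (2 * pi * (1 - v)).
  rewrite -[in LHS]cosN -[LHS](cosD2pi); congr cos; rewrite -mulr_natl; ring.
rewrite (cosE u) (cosE b) ltr_cos ?in_itv /=; [|apply/andP; split; nra|apply/andP; split; nra].
by rewrite ltr_pM2l ?ltrD2l ?ltrN2 //; nra.
Qed.

End FractionalPart.
(** * Orthogonality and completeness of the characters *)

Section Characters.
Context {R : realType} {d : nat}.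
Notation T := (Rd R d).
Notation V := 'rV[R]_d.
Local Notation Re := (@complex.Re R).
Local Notation Im := (@complex.Im R).
Variables (B : 'M[R]_d).

Definition chr (m : 'rV[int]_d) : V -> R[i] := fun x => e2pi (dotR (matv B (intv m)) x).

Lemma dotRE (x y : V) : dotR x y = (x *m y^T) 0 0.
Proof. by rewrite mxE; apply: eq_bigr => i _; rewrite !mxE. Qed.

Lemma dotRDr (x y z : V) : dotR x (y + z) = dotR x y + dotR x z.
Proof. by rewrite !dotRE linearD mulmxDr mxE. Qed.

Lemma dotRDl (x y z : V) : dotR (x + y) z = dotR x z + dotR y z.
Proof. by rewrite !dotRE mulmxDl mxE. Qed.

Lemma dot_matv (y x : V) : dotR (matv B y) x = dotR y (x *m B).
Proof. by rewrite !dotRE /matv trmx_mul trmxK trmx_mul mulmxA. Qed.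

Lemma dotR_int (m n : 'rV[int]_d) : dotR (intv m) (intv n : V) = (\sum_i m 0 i * n 0 i)%:~R.
Proof. by rewrite rmorph_sum /=; apply: eq_bigr => i _; rewrite !mxE -intrM. Qed.

Lemma chrE m x : chr m x = e2pi (dotR (intv m) (x *m B)).
Proof. by rewrite /chr dot_matv. Qed.

Lemma chrD m k x : chr (m + k) x = chr m x * chr k x.
Proof. by rewrite !chrE intvD dotRDl e2piD. Qed.

Lemma chr0 x : chr 0 x = 1.
Proof. by rewrite chrE intv0 dotRE mul0mx mxE e2pi0. Qed.

Lemma chrN m x : chr (- m) x = cconj (chr m x).
Proof. by rewrite !chrE intvN dotRE mulNmx mxE -dotRE e2piN. Qed.

Lemma cnorm2_chr m x : cnorm2 (chr m x) = 1.
Proof. by rewrite cnorm2_e2pi. Qed.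

Hypothesis uB : B \in unitmx.

Lemma chr_periodic m (x : V) n : chr m (x + intv n *m invmx B) = chr m x.
Proof.
by rewrite !chrE mulmxDl mulmxKV // dotRDr e2piD dotR_int e2pi_int mulr1.
Qed.

Lemma chr_translate_eqN1 m : m != 0 -> exists v : V, forall x, chr m (x + v) = - chr m x.
Proof.
move=> m0; have m1 : dotR (intv m) (intv m : V) != 0.
  rewrite dotR_int intr_eq0 psumr_neq0 => [|i _]; last by rewrite -expr2 sqr_ge0.
  have [i mi] : exists i, m 0 i != 0.
    apply/existsP; apply: contraNT m0 => /existsPn h.
    by apply/eqP/rowP => i; rewrite mxE; apply/eqP; have := h i; rewrite negbK.
  by apply/hasP; exists i; rewrite ?mem_index_enum //= -expr2 exprn_even_gt0.
(* Here [v *m B] is [m / (2 m.m)], whose pairing with [m] is 1/2, and [e2pi (1/2) = -1]. *)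
exists ((2^-1 / dotR (intv m) (intv m : V)) *: intv m *m invmx B) => x.
rewrite !chrE mulmxDl mulmxKV // dotRDr e2piD.
rewrite [dotR _ (_ *: _)]dotRE linearZ /= -scalemxAr mxE -dotRE mulfVK //.
by rewrite e2pi_half mulrN1.
Qed.

Lemma continuous_dotR (a : V) : continuous (fun x : V => dotR a x).
Proof.
apply: continuous_big => [|i _ x]; first exact: add_continuous.
by apply: continuousM; [exact: cst_continuous|exact: coord_continuous].
Qed.

Lemma cmeasurable_chr m : cmeasurable (chr m).
Proof.
split; apply: continuous_measurable_Rd => x /=.
- apply: (@continuous_comp _ _ _ (fun x : V => 2 * pi * dotR _ x) (@cos R));
    last exact: continuous_cos.
  by apply: continuousM; [exact: cst_continuous|exact: continuous_dotR].
- apply: (@continuous_comp _ _ _ (fun x : V => 2 * pi * dotR _ x) (@sin R));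
    last exact: continuous_sin.
  by apply: continuousM; [exact: cst_continuous|exact: continuous_dotR].
Qed.

Definition ind (D : set T) : V -> R[i] := fun x => (\1_D (x : T))%:C.

Lemma cmeasurable_ind D : measurable D -> cmeasurable (ind D).
Proof. by move=> mD; apply: cmeasurable_real; exact: measurable_indic. Qed.

Lemma indM_self D x : ind D x * ind D x = ind D x.
Proof. by rewrite /ind indicE -rmorphM /=; case: (x \in D); rewrite ?mulr1 ?mulr0. Qed.

Lemma cconj_ind D x : cconj (ind D x) = ind D x.
Proof. exact: cconj_real. Qed.

Lemma cnorm2_ind_le1 D x : cnorm2 (ind D x) <= 1.
Proof. by rewrite cnorm2_real indicE; case: (x \in D); rewrite ?expr1n // expr0n. Qed.

Variable mu : {measure set T -> \bar R}.
Hypothesis lebmu : is_lebesgue_Rd mu.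

Lemma Rintegral_indic (D : set T) (f : V -> R) : measurable D ->
  Rintegral mu [set: T] (fun x : T => f x * \1_D x) = Rintegral mu D (f : T -> R).
Proof.
move=> mD; rewrite [RHS]Rintegral_mkcond; apply: eq_Rintegral => x _.
by rewrite patchE indicE; case: ifP; rewrite ?mulr1 ?mulr0.
Qed.

Lemma fundom_translate (A : 'M[R]_d) (D : set T) v : fundom A D -> fundom A (translate v @^-1` D).
Proof.
move=> [mD ex un]; split.
- by apply: measurable_preimage => //; exact: measurable_translate.
- by move=> x; have [n Dn] := ex (x + v); exists n; rewrite /translate /= addrAC.
- by move=> x n Dx; rewrite /translate /= addrAC; exact: un Dx.
Qed.

Section Domain.
Variables (D : set T).
Hypothesis fD : fundom (invmx B) D.

Let mD : measurable D. Proof. by case: fD. Qed.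

Definition kappa := `|\det (invmx B)|.

Lemma kappa_gt0 : 0 < kappa.
Proof. by rewrite normr_gt0 -unitfE -unitmxE unitmx_inv. Qed.

Lemma mu_fundom : mu D = kappa%:E.
Proof. by apply: fundom_measure => //; rewrite unitmx_inv. Qed.

Lemma integrable_bounded (f : V -> R) (C : R) : measurable_fun [set: T] (f : T -> R) ->
  (forall x, `|f x| <= C) -> mu.-integrable D (fun x : T => (f x)%:E).
Proof.
move=> mf fC; apply: (@le_integrable _ _ _ _ _ mD _ (fun=> C%:E)).
- by apply/measurable_EFinP; exact: measurable_funS mf.
- by move=> x _; rewrite /= lee_fin (le_trans (fC x)) // ler_norm.
- apply/integrableP; split; first exact: measurable_cst.
  by rewrite integral_cst // mu_fundom ltry.
Qed.

(* Translation by [v] turns the integral of [1 + c] into that of [1 - c]. *)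
Lemma Rintegral_antiperiodic (c : V -> R) (v : V) : measurable_fun [set: T] (c : T -> R) ->
  (forall x, `|c x| <= 1) -> (forall x n, c (x + intv n *m invmx B) = c x) ->
  (forall x, c (x + v) = - c x) -> Rintegral mu D (c : T -> R) = 0.
Proof.
move=> mc c1 cper canti.
have ic := integrable_bounded mc c1.
have i1 : mu.-integrable D (fun _ : T => 1%:E).
  by apply: (@integrable_bounded (fun=> 1) 1) => // x; rewrite normr1.
have c1' x : 0 <= 1 + c x /\ 0 <= 1 - c x.
  by have := c1 x; rewrite ler_norml => /andP[? ?]; split; lra.
have mp : measurable_fun [set: T] (fun x : T => (1 + c x)%:E).
  by apply/measurable_EFinP; apply: measurable_funD => //; exact: measurable_cst.
have mm : measurable_fun [set: T] (fun x : T => (1 - c x)%:E).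
  by apply/measurable_EFinP; apply: measurable_funB => //; exact: measurable_cst.
(* The added constant 1 makes both integrands nonnegative, as [fundom_integral] and
   [integral_translate] demand. *)
have E : (\int[mu]_(x in D) (1 + c x)%:E = \int[mu]_(x in D) (1 - c x)%:E)%E.
  rewrite (fundom_integral lebmu fD (fundom_translate v fD) mp) => [|x|x n].
  - rewrite -(@integral_translate _ _ mu lebmu v (fun x : T => (1 - c x)%:E)) //.
      by apply: eq_integral => x _; rewrite /translate canti opprK.
    by move=> x; rewrite lee_fin; have [] := c1' x.
  - by rewrite lee_fin; have [] := c1' x.
  - by rewrite cper.
have {E} : Rintegral mu D (fun x : T => 1 + c x) = Rintegral mu D (fun x : T => 1 - c x).
  by rewrite /Rintegral E.
rewrite RintegralD // RintegralB //; lra.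
Qed.

Lemma Rintegral_chr m : m != 0 ->
  Rintegral mu D (fun x : T => Re (chr m x)) = 0 /\
  Rintegral mu D (fun x : T => Im (chr m x)) = 0.
Proof.
move=> m0; have [v hv] := chr_translate_eqN1 m0; have [mR mI] := cmeasurable_chr m.
split; apply: (@Rintegral_antiperiodic _ v) => //= [x|x n|x].
- exact: cos_max.
- by rewrite -[LHS]/(Re (chr m _)) chr_periodic.
- by rewrite -[LHS]/(Re (chr m _)) hv ReN.
- exact: sin_max.
- by rewrite -[LHS]/(Im (chr m _)) chr_periodic.
- by rewrite -[LHS]/(Im (chr m _)) hv ImN.
Qed.

Definition chr_on m : V -> R[i] := fun x => chr m x * ind D x.

Lemma rintegrable_indic : rintegrable mu (fun x : V => \1_D (x : T)).
Proof.
apply/integrableP; split; first by apply/measurable_EFinP; exact: measurable_indic.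
under eq_integral do rewrite gee0_abs ?lee_fin //.
by rewrite integral_indic // setIT mu_fundom ltry.
Qed.

Lemma L2_bounded_ind (f : V -> R[i]) (C : R) : cmeasurable f -> (forall x, cnorm2 (f x) <= C) ->
  L2 mu (fun x => f x * ind D x).
Proof.
move=> mf fC; apply: (@L2_le _ _ mu _ (fun x => C * \1_D (x : T))).
- by apply: cmeasurableM => //; exact: cmeasurable_ind.
- by apply: rintegrableZ; exact: rintegrable_indic.
- move=> x; rewrite cnorm2M cnorm2_real indicE; case: (x \in D).
    by rewrite expr1n !mulr1.
  by rewrite expr0n !mulr0.
Qed.

Lemma L2_chr_on m : L2 mu (chr_on m).
Proof.
apply: (@L2_bounded_ind _ 1); first exact: cmeasurable_chr.
by move=> x; rewrite cnorm2_chr.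
Qed.

Lemma inner_chr_on m k : inner mu (chr_on m) (chr_on k) = if m == k then kappa%:C else 0.
Proof.
have E (x : V) : chr_on m x * cconj (chr_on k x) = chr (m - k) x * ind D x.
  by rewrite /chr_on cconjM cconj_ind mulrACA indM_self chrD chrN.
have F : inner mu (chr_on m) (chr_on k) =
    Rintegral mu D (fun x : T => Re (chr (m - k) x)) +i*
    Rintegral mu D (fun x : T => Im (chr (m - k) x)).
  rewrite -(Rintegral_indic (fun x => Re (chr (m - k) x)) mD).
  rewrite -(Rintegral_indic (fun x => Im (chr (m - k) x)) mD); apply: eq_ReIm;
    apply: eq_Rintegral => x _; rewrite E !complexE /=.
    by rewrite mulr0 subr0.
  by rewrite mulr0 add0r.
rewrite F; case: eqP => [->|/eqP mk]; last first.
  have {}mk : m - k != 0 by rewrite subr_eq0.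
  by have [-> ->] := Rintegral_chr mk.
rewrite subrr; apply: eq_ReIm => /=.
  transitivity (Rintegral mu D (fun=> 1 : R)); last by rewrite Rintegral_cst // mu_fundom mul1r.
  by apply: eq_Rintegral => x _; rewrite -[LHS]/(Re (chr 0 x)) chr0.
transitivity (Rintegral mu D (fun=> 0 : R)); last by rewrite Rintegral_cst // mul0r.
by apply: eq_Rintegral => x _; rewrite -[LHS]/(Im (chr 0 x)) chr0.
Qed.

(** * Completeness: approximation by trigonometric polynomials *)

Definition trig_poly (p : V -> R[i]) := exists l : seq (R[i] * 'rV[int]_d),
  forall x, p x = \sum_(q <- l) q.1 * chr q.2 x.

Lemma trig_poly_cst c : trig_poly (fun=> c).
Proof. by exists [:: (c, 0)] => x; rewrite big_seq1 chr0 mulr1. Qed.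

Lemma trig_polyD p q : trig_poly p -> trig_poly q -> trig_poly (fun x => p x + q x).
Proof. by move=> [l1 h1] [l2 h2]; exists (l1 ++ l2) => x; rewrite big_cat h1 h2. Qed.

Lemma trig_polyM p q : trig_poly p -> trig_poly q -> trig_poly (fun x => p x * q x).
Proof.
move=> [l1 h1] [l2 h2]; exists [seq (a.1 * b.1, a.2 + b.2) | a <- l1, b <- l2] => x.
rewrite big_allpairs_dep h1 h2 mulr_suml; apply: eq_bigr => a _.
by rewrite mulr_sumr; apply: eq_bigr => b _ /=; rewrite chrD mulrACA.
Qed.

Lemma trig_polyX p n : trig_poly p -> trig_poly (fun x => p x ^+ n).
Proof.
move=> tp; elim: n => [|n IH]; first exact: (trig_poly_cst 1).
by under eq_fun do rewrite exprS; exact: trig_polyM.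
Qed.

Lemma cmeasurable_trig_poly p : trig_poly p -> cmeasurable p.
Proof.
move=> [l h]; rewrite (_ : p = fun x => \sum_(q <- l) q.1 * chr q.2 x); last exact/funext.
apply: cmeasurable_sum => q; apply: cmeasurableM; first exact: cmeasurable_cst.
exact: cmeasurable_chr.
Qed.

Lemma L2_trig_poly_ind p : trig_poly p -> L2 mu (fun x => p x * ind D x).
Proof.
move=> [l h]; rewrite (_ : (fun x => _) = fun x => \sum_(q <- l) q.1 * chr_on q.2 x).
  by apply: L2_sum => q; apply: L2Z; exact: L2_chr_on.
by apply/funext => x; rewrite h mulr_suml; apply: eq_bigr => q _; rewrite mulrA.
Qed.

(** The distance is measured on [D] only. Outside [D] the function is free, so a set may be replaced
    by a periodic one that agrees with it on [D]. *)
Definition approximable (phi : V -> R[i]) := L2 mu (fun x => phi x * ind D x) /\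
  forall eps : R, 0 < eps -> exists2 p, trig_poly p & n2 mu (fun x => (phi x - p x) * ind D x) <
    eps.

Lemma approximable_closed (phi : V -> R[i]) : L2 mu (fun x => phi x * ind D x) ->
  (forall eps : R, 0 < eps -> exists2 psi, approximable psi &
     n2 mu (fun x => (phi x - psi x) * ind D x) < eps) -> approximable phi.
Proof.
move=> Lphi h; split => // eps eps0; have e4 : 0 < eps / 4 by rewrite divr_gt0.
have [psi [Lpsi apsi] h1] := h _ e4; have [p tp h2] := apsi _ e4.
exists p => //; have Lp := L2_trig_poly_ind tp.
rewrite [X in n2 mu X](_ : _ = fun x => (phi x - psi x) * ind D x + (psi x - p x) * ind D x).
  apply: le_lt_trans (n2D_le _ _) _; last by lra.
    by under eq_fun do rewrite mulrBl; exact: L2B.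
  by under eq_fun do rewrite mulrBl; exact: L2B.
by apply/funext => x; rewrite -mulrDl addrA subrK.
Qed.

Lemma approximableD phi psi : approximable phi -> approximable psi ->
  approximable (fun x => phi x + psi x).
Proof.
move=> [L1 h1] [L2 h2]; split.
  by under eq_fun do rewrite mulrDl; exact: L2D.
move=> eps eps0; have e4 : 0 < eps / 4 by rewrite divr_gt0.
have [p1 t1 k1] := h1 _ e4; have [p2 t2 k2] := h2 _ e4.
exists (fun x => p1 x + p2 x); first exact: trig_polyD.
rewrite [X in n2 mu X](_ : _ = fun x => (phi x - p1 x) * ind D x + (psi x - p2 x) * ind D x).
  apply: le_lt_trans (n2D_le _ _) _; last by lra.
    by under eq_fun do rewrite mulrBl; apply: L2B => //; exact: L2_trig_poly_ind.
  by under eq_fun do rewrite mulrBl; apply: L2B => //; exact: L2_trig_poly_ind.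
by apply/funext => x; rewrite -mulrDl; congr (_ * _); rewrite opprD addrACA.
Qed.

Lemma approximableZ c phi : approximable phi -> approximable (fun x => c * phi x).
Proof.
move=> [L1 h1]; split.
  by under eq_fun do rewrite -mulrA; exact: L2Z.
move=> eps eps0; have c0 : 0 < cnorm2 c + 1 by rewrite ltr_wpDl ?cnorm2_ge0.
have [p t k] := h1 _ (divr_gt0 eps0 c0).
exists (fun x => c * p x); first by apply: trig_polyM => //; exact: trig_poly_cst.
have Lp : L2 mu (fun x => (phi x - p x) * ind D x).
  by under eq_fun do rewrite mulrBl; apply: L2B => //; exact: L2_trig_poly_ind.
rewrite [X in n2 mu X](_ : _ = fun x => c * ((phi x - p x) * ind D x)).
  apply: le_lt_trans (@n2_leM _ _ _ _ _ (cnorm2 c) (L2Z c Lp) Lp _) _.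
    by move=> x; rewrite cnorm2M.
  rewrite ltr_pdivlMr // in k; apply: le_lt_trans k; rewrite mulrC ler_wpM2l ?n2_ge0 //.
  by rewrite lerDl.
by apply/funext => x; rewrite -mulrBr mulrA.
Qed.

(** [D] has finite measure, so the constant [4 C] on [D] dominates the squared errors. *)
Lemma approximable_bounded_limit (P : nat -> V -> R[i]) (phi : V -> R[i]) (C : R) :
  cmeasurable phi -> (forall n, approximable (P n)) -> (forall n, cmeasurable (P n)) ->
  (forall n x, cnorm2 (P n x) <= C) ->
  (forall x, cnorm2 (phi x) <= C) -> (forall x, cnorm2 (phi x - P n x) @[n --> \oo] --> 0) ->
  approximable phi.
Proof.
move=> mphi aP mP PC phiC P0; apply: approximable_closed.
  exact: L2_bounded_ind phiC.
move=> eps eps0.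
have dC n x : cnorm2 (phi x - P n x) <= 4 * C.
  by apply: le_trans (cnorm2B_le _ _) _; have := PC n x; have := phiC x; lra.
have [n hn] : exists n, n2 mu (fun x => (phi x - P n x) * ind D x) < eps; last by exists (P n).
apply: (@n2_cvg0 _ _ mu (fun n x => (phi x - P n x) * ind D x)
  (fun x => 4 * C * \1_D (x : T))) => //.
- by move=> n; apply: (@L2_bounded_ind _ (4 * C)) => //; apply: cmeasurableD => //;
    exact: cmeasurableN.
- by apply: rintegrableZ; exact: rintegrable_indic.
- move=> n x; rewrite cnorm2M cnorm2_real indicE; case: (x \in D).
    by rewrite expr1n !mulr1.
  by rewrite expr0n !mulr0.
- move=> x; rewrite (_ : (fun n => _) = fun n => cnorm2 (phi x - P n x) * cnorm2 (ind D x)).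
    2: by apply/funext => n; rewrite cnorm2M.
  by rewrite -[X in _ --> X](mul0r (cnorm2 (ind D x))); apply: cvgM => //; exact: cvg_cst.
Qed.

Definition real_trig (s : V -> R) := trig_poly (fun x => (s x)%:C).

Lemma real_trig_cst c : real_trig (fun=> c).
Proof. exact: trig_poly_cst. Qed.

Lemma real_trigD s t : real_trig s -> real_trig t -> real_trig (fun x => s x + t x).
Proof. by rewrite /real_trig; under [X in _ -> _ -> trig_poly X]eq_fun do rewrite rmorphD;
  exact: trig_polyD. Qed.

Lemma real_trigM s t : real_trig s -> real_trig t -> real_trig (fun x => s x * t x).
Proof. by rewrite /real_trig; under [X in _ -> _ -> trig_poly X]eq_fun do rewrite rmorphM;
  exact: trig_polyM. Qed.

Lemma real_trigX s n : real_trig s -> real_trig (fun x => s x ^+ n).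
Proof. by rewrite /real_trig; under [X in _ -> trig_poly X]eq_fun do rewrite rmorphXn;
  exact: trig_polyX. Qed.

Lemma real_trig_prod (k : nat) (s : nat -> V -> R) : (forall i, real_trig (s i)) ->
  real_trig (fun x => \prod_(i < k) s i x).
Proof.
move=> ts; elim: k => [|k IH]; first by under eq_fun do rewrite big_ord0; exact: real_trig_cst.
by under eq_fun do rewrite big_ord_recr; exact: real_trigM.
Qed.

Lemma real_trig_Re m : real_trig (fun x => Re (chr m x)).
Proof.
exists [:: ((2^-1)%:C, m); ((2^-1)%:C, - m)] => x; rewrite big_cons big_seq1 /= chrN.
by apply: eq_ReIm; rewrite !complexE /=; field.
Qed.

Lemma real_trig_Im m : real_trig (fun x => Im (chr m x)).
Proof.
exists [:: (- (2^-1)%:C * 'i, m); ((2^-1)%:C * 'i, - m)] => x; rewrite big_cons big_seq1 /= chrN.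
by apply: eq_ReIm; rewrite !complexE /=; field.
Qed.

Lemma measurable_real_trig s : real_trig s -> measurable_fun [set: T] (s : T -> R).
Proof. by move=> /cmeasurable_trig_poly []. Qed.

(* These sets form a pi-system, and [threshold n] applied to the [t i] approximates
   their indicators by trigonometric polynomials, boundedly and pointwise. *)
Definition trig_system : set (set T) := [set E | exists (k : nat) (t : nat -> V -> R),
  [/\ forall i, real_trig (t i), forall i x, 0 <= t i x <= 1
    & E = [set x | forall i, (i < k)%N -> t i x < 2^-1]]].

Lemma trig_system_setI : setI_closed trig_system.
Proof.
move=> _ _ [k1 [t1 [r1 b1 ->]]] [k2 [t2 [r2 b2 ->]]].
exists (k1 + k2)%N, (fun i => if (i < k1)%N then t1 i else t2 (i - k1)%N); split.
- by move=> i; case: ifP.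
- by move=> i x; case: ifP.
- apply/seteqP; split => [x [h1 h2] i ik|x h].
    by case: ltnP => [|ki]; [exact: h1|apply: h2; rewrite ltn_subLR].
  split => i ik.
    by have := h i (leq_trans ik (leq_addr _ _)); rewrite ik.
  have := h (k1 + i)%N; rewrite ltn_add2l => /(_ ik).
  by rewrite ltnNge leq_addr /= addKn.
Qed.

Lemma ind_sublevel k (t : nat -> V -> R) x :
  ind [set x : T | forall i, (i < k)%N -> t i x < 2^-1] x =
  (\prod_(i < k) (if t i x < 2^-1 then 1 else 0))%:C.
Proof.
congr (_%:C); have [h|nh] := pselect (forall i, (i < k)%N -> t i x < 2^-1).
  by rewrite indicE mem_set // big1 // => i _; rewrite h.
rewrite indicE memNset //=; move/existsNP: nh => [i /not_implyP[ik /negP ht]].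
by rewrite (bigD1 (Ordinal ik)) //= (negbTE ht) mul0r.
Qed.

Lemma measurable_trig_system E : trig_system E -> measurable E.
Proof.
move=> [k [t [rt bt ->]]].
rewrite (_ : [set x | _] = \bigcap_(i in `I_k) ((t i : T -> R) @^-1` `]-oo, 2^-1[)).
  apply: fin_bigcap_measurable; first exact: finite_II.
  move=> i _; apply: measurable_preimage; first exact: measurable_real_trig.
  exact: measurable_itv.
by apply/seteqP; split => x h i /= ik; have := h i ik; rewrite /= in_itv.
Qed.

Lemma approximable_trig_system E : trig_system E -> approximable (ind E).
Proof.
move=> tE; have mE := measurable_trig_system tE; case: tE => [k [t [rt bt EE]]].
pose P n x := \prod_(i < k) threshold n (t i x).
have P01 n x : 0 <= P n x <= 1.
  rewrite prodr_ge0 => [|i _]; last by have /andP[] := threshold_itv n (bt i x).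
  by rewrite prodr_ile1 // => i _; exact: threshold_itv.
have tP n : real_trig (P n).
  apply: (@real_trig_prod k (fun i x => threshold n (t i x))) => i.
  apply: real_trigX; apply: real_trigD; first exact: real_trig_cst.
  under eq_fun do rewrite -mulN1r.
  by apply: real_trigM; [exact: real_trig_cst|exact: real_trigX].
have c2P n x : cnorm2 (P n x)%:C <= 1.
  by have /andP[h0 h1] := P01 n x; rewrite cnorm2_real expr_le1.
apply: (@approximable_bounded_limit (fun n x => (P n x)%:C) _ 1) => //.
- exact: cmeasurable_ind.
- move=> n; split; first exact: (L2_trig_poly_ind (tP n)).
  move=> eps eps0; exists (fun x => (P n x)%:C); first exact: tP.
  rewrite [X in n2 mu X](_ : _ = fun=> 0); last by apply/funext => x; rewrite subrr mul0r.
  by rewrite /n2; under eq_Rintegral do rewrite cnorm2_0; rewrite Rintegral_cst // mul0r.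
- by move=> n; exact: (cmeasurable_trig_poly (tP n)).
- by move=> x; exact: cnorm2_ind_le1.
move=> x; rewrite EE.
rewrite ind_sublevel.
set l := \prod_(i < k) _.
have Pl : P n x @[n --> \oo] --> l.
  apply: cvg_big => [|i _]; last exact: threshold_cvg.
  by move=> y; apply: (@continuousM _ _ (fst) snd); [exact: cvg_fst|exact: cvg_snd].
exact: cvg_cnorm2_real.
Qed.

(** Pi-lambda argument: linearity gives differences of nested sets and bounded limits give
    increasing unions, which is what a lambda-system asks for beyond the whole space. *)
Lemma approximable_trig_sigma E : <<s trig_system >> E -> measurable E /\ approximable (ind E).
Proof.
move: E; apply: (@lambda_system_subset _ trig_system trig_system_setI [set: T]
   [set E | measurable E /\ approximable (ind E)]) => //; last first.
  by move=> E tE; split; [exact: measurable_trig_system|exact: approximable_trig_system].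
split.
- by [].
- split; first exact: measurableT.
  apply: approximable_trig_system; exists 0%N, (fun _ _ => 0); split => //.
  + by move=> _; exact: real_trig_cst.
  + by move=> _ _; rewrite lexx ler01.
  + by apply/seteqP; split.
- move=> E F FE [mE aE] [mF aF]; split; first exact: measurableD.
  rewrite (_ : ind (E `\` F) = fun x => ind E x + (-1) * ind F x).
    by apply: approximableD => //; exact: approximableZ.
  apply/funext => x; rewrite /ind mulN1r -rmorphB; congr (_%:C) => /=.
  rewrite !indicE in_setD; have [xF|xF] /= := boolP (x \in F); last by rewrite andbT subr0.
  by rewrite andbF mem_set ?subrr //; apply: FE; exact: set_mem.
- move=> F ndF hF; have mU : measurable (\bigcup_i F i) by apply: bigcupT_measurable => i;
    have [] := hF i.
  split => //; apply: (@approximable_bounded_limit (fun n => ind (F n)) _ 1).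
  + exact: cmeasurable_ind.
  + by move=> n; have [] := hF n.
  + by move=> n; apply: cmeasurable_ind; have [] := hF n.
  + by move=> n x; exact: cnorm2_ind_le1.
  + by move=> x; exact: cnorm2_ind_le1.
  + move=> x; apply: (@cvg_near_cst _ _ _ _ _) => //.
    have [[k _ Fk]|nF] := pselect ((\bigcup_i F i) x).
      near=> n; rewrite /ind !indicE !mem_set ?subrr ?cnorm2_0 //; last by exists k.
      have kn : (k <= n)%N by near: n; exact: nbhs_infty_ge.
      by have /subsetPset := ndF _ _ kn; apply.
    near=> n; rewrite /ind !indicE !memNset ?subrr ?cnorm2_0 // => Fn.
    by apply: nF; exists n.
Unshelve. all: by end_near. Qed.

Local Notation Ttrig := (g_sigma_algebraType trig_system).

Lemma trig_measurable_bounded s (C : R) : real_trig s -> (forall x, `|s x| <= C) ->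
  measurable_fun [set: Ttrig] (s : Ttrig -> R).
Proof.
move=> rs sC; apply: (measurability _ (RGenInftyO.measurableE R)) => _ [_ [r ->] <-].
rewrite setTI; apply: sub_sigma_algebra.
have C0 : 0 <= C by apply: le_trans (sC 0).
(* Rescaling: [1/2 + (s - r) / c] takes values in [[0,1]], and it is below 1/2 exactly where
   [s < r]. *)
pose c := 2 * (C + `|r| + 1); have c0 : 0 < c by rewrite /c; have := normr_ge0 r; lra.
exists 1%N, (fun _ x => 2^-1 + c^-1 * (s x + - r)); split.
- move=> _; apply: real_trigD; first exact: real_trig_cst.
  apply: real_trigM; first exact: real_trig_cst.
  by apply: real_trigD => //; exact: real_trig_cst.
- move=> _ x.
  have h : `|c^-1 * (s x - r)| <= 2^-1.
    rewrite normrM normfV (gtr0_norm c0) ler_pdivrMl //.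
    apply: le_trans (ler_normB _ _) _; have := sC x; rewrite /c; lra.
  by move: h; rewrite ler_norml => /andP[h1 h2]; apply/andP; split; lra.
- apply/seteqP; split => [x|x].
    rewrite /= in_itv /= => h i _; rewrite gtrDl pmulr_rlt0 ?invr_gt0 //; lra.
  move=> /(_ 0%N isT); rewrite gtrDl pmulr_rlt0 ?invr_gt0 // => h.
  by rewrite /= in_itv /=; lra.
Qed.

Lemma chr_delta j x : chr (delta_mx 0 j) x = e2pi ((x *m B) 0 j).
Proof.
rewrite chrE; congr e2pi; rewrite /dotR (bigD1 j) //= big1 ?addr0 => [|i ij].
  by rewrite !mxE !eqxx mul1r.
by rewrite !mxE (negbTE ij) andbF mul0r.
Qed.

(** Half-lines ending at [b <= 0] or [b > 1] give the empty or the full set; in between, the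
    preimage is described by the sine and cosine of one coordinate, which are real and imaginary
    part of a character. *)
Lemma trig_measurable_frac j :
  measurable_fun [set: Ttrig] (fun x : Ttrig => frac (((x : V) *m B) 0 j)).
Proof.
pose y (x : V) := (x *m B) 0 j.
have mcos : measurable_fun [set: Ttrig] (fun x : Ttrig => cos (2 * pi * y x)).
  apply: (@trig_measurable_bounded (fun x => cos (2 * pi * y x)) 1) => [|x]; last exact: cos_max.
  by rewrite (_ : (fun x => _) = fun x => Re (chr (delta_mx 0 j) x));
    [exact: real_trig_Re|apply/funext => x; rewrite chr_delta].
have msin : measurable_fun [set: Ttrig] (fun x : Ttrig => sin (2 * pi * y x)).
  apply: (@trig_measurable_bounded (fun x => sin (2 * pi * y x)) 1) => [|x]; last exact: sin_max.
  by rewrite (_ : (fun x => _) = fun x => Im (chr (delta_mx 0 j) x));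
    [exact: real_trig_Im|apply/funext => x; rewrite chr_delta].
apply: (measurability _ (RGenInftyO.measurableE R)) => _ [_ [b ->] <-]; rewrite setTI.
have [b0|b0] := leP b 0.
  rewrite (_ : _ @^-1` _ = set0) //; apply/seteqP; split => x //=; rewrite in_itv /= => h.
  by have /andP[h0 _] := frac_itv (y x); move: (lt_le_trans h b0); rewrite ltNge h0.
have [b1|b1] := leP b 1; last first.
  rewrite (_ : _ @^-1` _ = setT) //; apply/seteqP; split => x //= _; rewrite in_itv /=.
  by have /andP[_ h1] := frac_itv (y x); exact: lt_trans b1.
have [b2|b2] := leP b 2^-1.
  rewrite (_ : _ @^-1` _ = (fun x : Ttrig => sin (2 * pi * y x)) @^-1` `[0, +oo[ `&`
     (fun x : Ttrig => cos (2 * pi * y x)) @^-1` `]cos (2 * pi * b), +oo[).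
    by apply: measurableI; apply: measurable_preimage => //; exact: measurable_itv.
  apply/seteqP; split => x /=; rewrite !in_itv /= !andbT frac_lt_cos_le ?b0 //.
    by move/andP.
  by case=> -> ->.
rewrite (_ : _ @^-1` _ = (fun x : Ttrig => sin (2 * pi * y x)) @^-1` `[0, +oo[ `|`
   (fun x : Ttrig => cos (2 * pi * y x)) @^-1` `]-oo, cos (2 * pi * b)[).
  by apply: measurableU; apply: measurable_preimage => //; exact: measurable_itv.
apply/seteqP; split => x /=; rewrite !in_itv /= !andbT frac_lt_cos_gt ?b1 ?b2 //.
  by move/orP.
by move=> h; apply/orP.
Qed.

(* A periodic set is the preimage of itself under reduction modulo the lattice,
   which is measurable because its coordinates are read off cosines and sines. *)
Lemma trig_sigma_periodic (E : set T) : measurable E ->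
  (forall (x : V) n, E x -> E (x + intv n *m invmx B)) -> <<s trig_system >> E.
Proof.
move=> mE Eper.
pose fr (x : V) : V := \row_j frac ((x *m B) 0 j).
have mfr : measurable_fun [set: Ttrig] (fun x : Ttrig => fr x *m invmx B : T).
  apply: (@measurableT_comp _ _ _ _ _ _ (fun x : T => (x : V) *m invmx B : T)).
    exact: measurable_mulmx.
  apply: measurable_fun_coords => j; under eq_fun do rewrite mxE.
  exact: trig_measurable_frac.
have frE x : fr x *m invmx B = x + intv (\row_j - Num.floor ((x *m B) 0 j)) *m invmx B.
  rewrite -[X in X + _](mulmxK uB) -mulmxDl; congr (_ *m _).
  by apply/rowP => j; rewrite !mxE mulrNz.
have -> : E = (fun x : Ttrig => fr x *m invmx B : T) @^-1` E.
  apply/seteqP; split => x /=; rewrite frE; first exact: Eper.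
  move=> /(Eper _ (- (\row_j - Num.floor ((x *m B) 0 j)))).
  by rewrite intvN mulNmx addrK.
exact: measurable_preimage mfr mE.
Qed.

Lemma approximable_eq phi psi : (forall x, phi x * ind D x = psi x * ind D x) ->
  approximable phi -> approximable psi.
Proof.
move=> e [L h]; split; first by rewrite -(funext e).
move=> eps /h [p tp hp]; exists p => //;
  rewrite (_ : (fun x => _) = fun x => (phi x - p x) * ind D x) //.
by apply/funext => x; rewrite !mulrBl e.
Qed.

(** [E'] is the periodic set that agrees with [E] on [D]. *)
Lemma approximable_ind E : measurable E -> approximable (ind E).
Proof.
move=> mE; have [_ exD unD] := fD.
pose E' := \bigcup_(n in [set: 'rV[int]_d]) translate (intv n *m invmx B) @^-1` (E `&` D).
have mE' : measurable E'.
  apply: countable_bigcupT_measurable; first exact: countableP.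
  move=> n; apply: measurable_preimage; [exact: measurable_translate|exact: measurableI].
have [|_] := approximable_trig_sigma (E := E').
  apply: trig_sigma_periodic => // x n [m _ hm]; exists (m - n) => //.
  rewrite /preimage /mkset (_ : translate _ _ = translate (intv m *m invmx B) x) // /translate
    intvB mulmxBl.
  by rewrite addrACA subrr addr0.
apply: approximable_eq => x.
have [Dx|nDx] := pselect (D x); last by rewrite {2 4}/ind indicE memNset // !mulr0.
congr (_ * _); congr (_%:C); rewrite !indicE; congr (nat_of_bool _)%:R.
apply/idP/idP => /set_mem h; apply/mem_set.
  case: h => n _ [En Dn]; have n0 := unD _ _ Dx Dn.
  by move: En; rewrite n0 /translate intv0 mul0mx addr0.
by exists 0 => //; rewrite /translate /= intv0 mul0mx addr0.
Qed.

Lemma approximable_sum (I : Type) (s : seq I) (F : I -> V -> R[i]) :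
  (forall i, approximable (F i)) -> approximable (fun x => \sum_(i <- s) F i x).
Proof.
move=> aF; elim: s => [|i s IH]; last by under eq_fun do rewrite big_cons; exact: approximableD.
apply: (@approximable_eq (fun x => 0 * ind set0 x)).
  by move=> x; rewrite big_nil !mul0r.
by apply: approximableZ; apply: approximable_ind.
Qed.

(** Simple functions increasing to [F] keep the squared error on [D] below [F^2], which is
    integrable there. *)
Lemma approximable_nonneg (F : V -> R) : measurable_fun [set: T] (F : T -> R) ->
  (forall x, 0 <= F x) -> L2 mu (fun x => (F x)%:C * ind D x) -> approximable (fun x => (F x)%:C).
Proof.
move=> mF F0 LF.
have mEF : measurable_fun [set: T] (fun x : T => (F x)%:E) by exact/measurable_EFinP.
pose S (n : nat) : {nnsfun T >-> R} := nnsfun_approx measurableT mEF n.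
have S0 n x : 0 <= S n x by [].
have EF0 (x : T) : [set: T] x -> (0 <= (F x)%:E)%E by rewrite lee_fin.
have Scvg x : S n x @[n --> \oo] --> F x.
  have := @cvg_nnsfun_approx _ _ _ _ measurableT _ mEF EF0 x Logic.I.
  by move/fine_cvgP => [].
have SF n x : S n x <= F x.
  rewrite -(cvg_lim _ (Scvg x)) //.
  apply: nondecreasing_cvgn_le; last by apply/cvg_ex; exists (F x).
  by move=> a b ab; have /lefP := nd_nnsfun_approx measurableT mEF ab; apply.
have aS n : approximable (fun x => (S n x)%:C).
  have -> : (fun x : V => (S n x)%:C) = fun x =>
      \sum_(r <- finmap.enum_fset (fset_set (range (S n)))) r%:C * ind (S n @^-1` [set r]) x.
    apply/funext => x; rewrite {1}(fimfunE (S n) x) fsbig_finite //= rmorph_sum.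
    by apply: eq_bigr => r _; rewrite rmorphM.
  by apply: approximable_sum => r; apply: approximableZ; apply: approximable_ind.
apply: approximable_closed => // eps eps0.
have [n hn] : exists n, n2 mu (fun x => ((F x)%:C - (S n x)%:C) * ind D x) < eps;
  last by exists (fun x => (S n x)%:C).
apply: (@n2_cvg0 _ _ mu (fun n x => ((F x)%:C - (S n x)%:C) * ind D x) (fun x => cnorm2 ((F x)%:C
  * ind D x))) => //.
- by move=> n; under eq_fun do rewrite mulrBl; apply: L2B => //; have [] := aS n.
- exact: L2_cnorm2.
- move=> n x; rewrite !cnorm2M ler_wpM2r ?cnorm2_ge0 // -rmorphB !cnorm2_real.
  have := S0 n x; have := SF n x => h1 h2.
  by rewrite lerXn2r ?nnegrE ?subr_ge0 // ?gerBl // (le_trans h2).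
- move=> x; rewrite (_ : (fun n => _) = fun n => cnorm2 ((F x)%:C - (S n x)%:C) * cnorm2 (ind D x)).
    by rewrite -[X in _ --> X](mul0r (cnorm2 (ind D x))); apply: cvgM;
      [exact: cvg_cnorm2_real|exact: cvg_cst].
  by apply/funext => n; rewrite cnorm2M.
Qed.

Lemma approximable_real (F : V -> R) : measurable_fun [set: T] (F : T -> R) ->
  L2 mu (fun x => (F x)%:C * ind D x) -> approximable (fun x => (F x)%:C).
Proof.
move=> mF LF.
have mN : measurable_fun [set: T] (fun x : T => `|F x|) by exact: measurableT_comp.
(* [e = 1] and [e = -1] give the positive and the negative part of [F]. *)
have part (e : R) : `|e| = 1 -> approximable (fun x => (2^-1 * (`|F x| + e * F x))%:C).
  move=> e1; have mp : measurable_fun [set: T] (fun x : T => 2^-1 * (`|F x| + e * F x)).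
    apply: measurable_funM; first exact: measurable_cst.
    by apply: measurable_funD => //; apply: measurable_funM => //; exact: measurable_cst.
  have le x : `|e * F x| <= `|F x| by rewrite normrM e1 mul1r.
  have p0 x : 0 <= 2^-1 * (`|F x| + e * F x).
    by have := le x; rewrite ler_norml => /andP[]; lra.
  apply: approximable_nonneg => //.
  apply: (@L2_le _ _ mu _ (fun x => cnorm2 ((F x)%:C * ind D x))).
  - by apply: cmeasurableM; [exact: cmeasurable_real|exact: cmeasurable_ind].
  - exact: L2_cnorm2.
  - move=> x; rewrite !cnorm2M ler_wpM2r ?cnorm2_ge0 // !cnorm2_real -[F x ^+ 2]real_normK
    ?num_real //.
    have := le x; rewrite ler_norml => /andP[h1 h2].
    by rewrite lerXn2r ?nnegrE //; have := p0 x; lra.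
have a1 := part 1 (normr1 _); have a2 := part (-1) (normrN1 _).
have := approximableD a1 (approximableZ (-1) a2).
apply: approximable_eq => x; congr (_ * _); rewrite mulN1r -rmorphB; congr (_%:C); by field.
Qed.

Lemma chr_complete (f : V -> R[i]) (eps : R) : L2 mu f -> (forall x, ~ D x -> f x = 0) -> 0 < eps ->
  exists l : seq (R[i] * 'rV[int]_d), n2 mu (fun x => f x - \sum_(q <- l) q.1 * chr_on q.2 x) < eps.
Proof.
move=> Lf f0 eps0; have [mR mI] := L2_measurable Lf.
have fD' x : f x * ind D x = f x.
  have [Dx|nDx] := pselect (D x); first by rewrite /ind indicE mem_set // mulr1.
  by rewrite f0 // mul0r.
have LR : L2 mu (fun x => (Re (f x))%:C * ind D x).
  apply: (@L2_le _ _ mu _ _ _ (L2_cnorm2 Lf)).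
    by apply: cmeasurableM; [exact: cmeasurable_real|exact: cmeasurable_ind].
  move=> x; rewrite -[in X in _ <= X]fD' !cnorm2M ler_wpM2r ?cnorm2_ge0 // cnorm2_real.
  by rewrite lerDl sqr_ge0.
have LI : L2 mu (fun x => (Im (f x))%:C * ind D x).
  apply: (@L2_le _ _ mu _ _ _ (L2_cnorm2 Lf)).
    by apply: cmeasurableM; [exact: cmeasurable_real|exact: cmeasurable_ind].
  move=> x; rewrite -[in X in _ <= X]fD' !cnorm2M ler_wpM2r ?cnorm2_ge0 // cnorm2_real.
  by rewrite lerDr sqr_ge0.
have [_ /(_ _ eps0) [p [l hl] hp]] : approximable f.
  have := approximableD (approximable_real mR LR) (approximableZ 'i (approximable_real mI LI)).
  by apply: approximable_eq => x; congr (_ * _); apply: eq_ReIm; rewrite !complexE /=; ring.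
exists l; rewrite (_ : (fun x => _) = fun x => (f x - p x) * ind D x) //.
apply/funext => x; rewrite mulrBl fD' hl mulr_suml; congr (_ - _).
by apply: eq_bigr => q _; rewrite mulrA.
Qed.

End Domain.
End Characters.
(** * Smoothness of the windows *)

Section Smooth.
Context {R : realType} {d : nat}.
Notation V := 'rV[R]_d.

(** Sines with an arbitrary phase include cosines, so one transcendental constructor makes the class
    closed under directional derivatives. No constructor leads to an unbounded function. *)
Inductive smooth : (V -> R) -> Prop :=
| smooth_cst c : smooth (fun=> c)
| smooth_sin a b : smooth (fun x => sin (dotR a x + b))
| smoothD f g : smooth f -> smooth g -> smooth (fun x => f x + g x)
| smoothM f g : smooth f -> smooth g -> smooth (fun x => f x * g x).

Lemma smooth_continuous f : smooth f -> continuous f.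
Proof.
elim=> [c|a b|u v _ cu _ cv|u v _ cu _ cv] x.
- exact: cst_continuous.
- apply: (@continuous_comp _ _ _ (fun x : V => dotR a x + b) (@sin R)); last exact: continuous_sin.
  by apply: continuousD; [exact: continuous_dotR|exact: cst_continuous].
- by apply: continuousD; [exact: cu|exact: cv].
- by apply: continuousM; [exact: cu|exact: cv].
Qed.

Lemma is_derive_congr (W : normedModType R) (f g : W -> R) (x v : W) (df dg : R) :
  is_derive x v f df -> f =1 g -> df = dg -> is_derive x v g dg.
Proof. by move=> h /funext <- <-. Qed.

(** A directional derivative sees only the restriction to a line, so one-variable rules become
    available. *)
Lemma is_derive_line (f : V -> R) (x v : V) (df : R) :
  is_derive (0 : R) 1 (fun t : R => f (t *: v + x)) df -> is_derive x v f df.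
Proof.
move=> [h1 h2]; have E : (fun h : R => h^-1 *: ((f \o shift x) (h *: v) - f x)) =
  (fun h : R => h^-1 *: (((fun t : R => f (t *: v + x)) \o shift 0) (h *: 1) - f (0 *: v + x))).
  by apply/funext => h /=; rewrite addr0 scale0r add0r [h *: 1]mulr1.
by split; [rewrite /derivable E|rewrite /derive E].
Qed.

Lemma is_derive_sin_dot (a : V) (b : R) (x v : V) :
  is_derive x v (fun x => sin (dotR a x + b)) (sin (dotR a x + (b + pi / 2)) * dotR a v).
Proof.
apply: is_derive_line.
rewrite (_ : (fun t : R => _) = (@sin R) \o (fun t : R => dotR a x + b + dotR a v * t)); last first.
  apply/funext => t /=; congr sin; rewrite !dotRE linearD mulmxDr mxE linearZ -scalemxAr mxE.
  by rewrite -!dotRE mulrC; ring.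
rewrite (_ : sin _ = cos (dotR a x + b + dotR a v * 0)); last first.
  by rewrite mulr0 addr0 addrA sinDpihalf.
apply: is_derive1_comp.
apply: is_derive_congr (is_deriveD (is_derive_cst (dotR a x + b) (0 : R) 1)
  (is_deriveZ (dotR a v) (is_derive_id (0 : R) 1))) _ _ => //.
by rewrite add0r [_ *: 1]mulr1.
Qed.

Lemma smooth_is_derive f (v : V) : smooth f ->
  exists2 f', smooth f' & forall x, is_derive x v f (f' x).
Proof.
elim=> [c|a b|u w su [u' su' hu] sw [w' sw' hw]|u w su [u' su' hu] sw [w' sw' hw]].
- by exists (fun=> 0); [exact: smooth_cst|move=> x; exact: is_derive_cst].
- exists (fun x => sin (dotR a x + (b + pi / 2)) * dotR a v); last by move=> x;
    exact: is_derive_sin_dot.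
  by apply: smoothM; [exact: smooth_sin|exact: smooth_cst].
- exists (fun x => u' x + w' x); first exact: smoothD.
  by move=> x; apply: is_deriveD.
- exists (fun x => u x * w' x + w x * u' x); first by apply: smoothD; exact: smoothM.
  by move=> x; apply: is_deriveM.
Qed.

Lemma smoothX f n : smooth f -> smooth (fun x => f x ^+ n).
Proof.
move=> sf; elim: n => [|n IH]; first exact: (smooth_cst 1).
by under eq_fun do rewrite exprS; exact: smoothM.
Qed.

Lemma smooth_sum (I : Type) (s : seq I) (F : I -> V -> R) : (forall i, smooth (F i)) ->
  smooth (fun x => \sum_(i <- s) F i x).
Proof.
move=> sF; elim: s => [|i s IH]; first by under eq_fun do rewrite big_nil; exact: smooth_cst.
by under eq_fun do rewrite big_cons; exact: smoothD.
Qed.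

Lemma smooth_prod (I : Type) (s : seq I) (F : I -> V -> R) : (forall i, smooth (F i)) ->
  smooth (fun x => \prod_(i <- s) F i x).
Proof.
move=> sF; elim: s => [|i s IH]; first by under eq_fun do rewrite big_nil; exact: smooth_cst.
by under eq_fun do rewrite big_cons; exact: smoothM.
Qed.

Lemma smooth_real_trig_poly N f : real_trig_poly N f -> smooth f.
Proof.
move=> [S [a h]].
pose w (k : 'rV[int]_d) : V := (2 * pi / N%:R) *: intv k.
have wE k x : dotR (w k) x = 2 * pi * (dotR (intv k) x / N%:R).
  by rewrite !dotRE -scalemxAl mxE; ring.
(* Real part of [a e^(i theta)], with the cosine written as a shifted sine. *)
have -> : f = fun x => \sum_(k <- S) (complex.Re (a k) * sin (dotR (w k) x + pi / 2) +
    (- complex.Im (a k)) * sin (dotR (w k) x + 0)).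
  apply/funext => x; rewrite -[LHS]/(complex.Re (f x)%:C) h Re_sum; apply: eq_bigr => k _.
  by rewrite ReM /= addr0 sinDpihalf wE mulNr.
apply: smooth_sum => k.
by apply: smoothD; apply: smoothM; first [exact: smooth_cst|exact: smooth_sin].
Qed.

Lemma smooth_sin_prod N : smooth (sin_prod N).
Proof.
apply: smooth_prod => j.
rewrite (_ : (fun x => _) = fun x => sin (dotR ((pi / N%:R) *: delta_mx 0 j) x + 0)).
  exact: smooth_sin.
apply/funext => x; congr sin; rewrite addr0 /dotR (bigD1 j) //= big1 ?addr0 => [|i ij].
  by rewrite !mxE !eqxx /= mulr1 mulrAC.
by rewrite !mxE (negbTE ij) andbF mulr0 mul0r.
Qed.

(** * Cutting off by the indicator of the cube *)

Section Cutoff.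
Variable N : nat.
Hypothesis N_gt0 : (0 < N)%N.

(** The indicator can jump only where some coordinate is 0 or [N], and there the corresponding sine
    vanishes. *)
Lemma chi_cube_cases (x : V) : (exists c : R, \forall y \near x,
  chi_cube N y = c) \/ sin_prod N x = 0.
Proof.
have cc i : continuous (fun y : V => y 0 i) by exact: coord_continuous.
have [h|] := pselect (forall i, 0 < x 0 i < N%:R).
  left; exists 1.
  have : \forall y \near x, forall i, 0 < (y : V) 0 i < N%:R.
      apply: (@filter_forall _ _ (fun (i : 'I_d) (y : V) => is_true (0 < y 0 i < N%:R)) (nbhs x))
        => i.
    have /andP[h1 h2] := h i.
    have a1 : nbhs x [set y : V | 0 < y 0 i] := cc i x _ (lt_nbhsr h1).
    have a2 : nbhs x [set y : V | y 0 i < N%:R] := cc i x _ (lt_nbhsl h2).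
    by near=> y; apply/andP; split; near: y.
  apply: filterS => y hy; rewrite /chi_cube asboolT // => i.
  by have /andP[/ltW -> /ltW ->] := hy i.
move=> /existsNP [i /negP]; rewrite negb_and -!leNgt => hi.
have [xi0|xi0] := eqVneq (x 0 i) 0.
  by right; rewrite /sin_prod (bigD1 i) //= xi0 mulr0 mul0r sin0 mul0r.
have [xiN|xiN] := eqVneq (x 0 i) N%:R.
  by right; rewrite /sin_prod (bigD1 i) //= xiN mulfK ?pnatr_eq0 -?lt0n // sinpi mul0r.
left; exists 0.
have : \forall y \near x, ~ (0 <= (y : V) 0 i <= N%:R).
  case/orP: hi => hi.
    have : \forall y \near x, (y : V) 0 i < 0 by apply: (cc i x _ (lt_nbhsl _));
      rewrite lt_neqAle xi0.
    by apply: filterS => y hy /andP[]; rewrite leNgt hy.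
  have : \forall y \near x, N%:R < (y : V) 0 i by apply: (cc i x _ (lt_nbhsr _));
    rewrite lt_neqAle eq_sym xiN.
  by apply: filterS => y hy /andP[_]; rewrite leNgt hy.
by apply: filterS => y hy; rewrite /chi_cube asboolF // => /(_ i).
Unshelve. all: by end_near. Qed.

Lemma chi_cube_norm_le1 (x : V) : `|chi_cube N x| <= 1.
Proof. by rewrite /chi_cube; case: asboolP; rewrite ?normr1 ?normr0. Qed.

Lemma continuous_cutoff M F : smooth F ->
  continuous (fun x => sin_prod N x ^+ M.+1 * F x * chi_cube N x).
Proof.
move=> sF; have sG : smooth (fun x => sin_prod N x ^+ M.+1 * F x).
  by apply: smoothM => //; apply: smoothX; exact: smooth_sin_prod.
have cG := smooth_continuous sG.
suff H (x : V) : continuous_at x (fun x => sin_prod N x ^+ M.+1 * F x * chi_cube N x).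
  by move=> x; exact: H.
case: (chi_cube_cases x) => [[c hc]|x0].
  have h : {for x, continuous (fun y => sin_prod N y ^+ M.+1 * F y * c)}.
    by apply: continuousM; [exact: cG|exact: cst_continuous].
  rewrite /continuous_at [X in _ --> X](_ : _ = sin_prod N x ^+ M.+1 * F x * c); last first.
    by rewrite (nbhs_singleton hc).
  have hc' : {near x, (fun y => sin_prod N y ^+ M.+1 * F y * c) =1
      (fun y => sin_prod N y ^+ M.+1 * F y * chi_cube N y)} by near=> y; rewrite (near hc y).
  exact: cvg_trans (near_eq_cvg hc') h.
(* At a zero of the sine product the cutoff is dominated by the smooth function, which tends to
   0. *)
have h : continuous_at x (fun y => `|sin_prod N y ^+ M.+1 * F y|).
  exact: (continuous_comp (cG x) (@norm_continuous _ _ _)).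
rewrite /continuous_at x0 expr0n mul0r mul0r.
move: h; rewrite /continuous_at x0 expr0n mul0r normr0 => h.
have h' : `|sin_prod N y ^+ M.+1 * F y * chi_cube N y| @[y --> x] --> (0 : R).
  apply: (@squeeze_cvgr _ (nbhs x) (nbhs_filter x) _ (fun=> 0) (fun y => `|sin_prod N y ^+ M.+1 *
    F y|)) => //.
    by near=> y; rewrite normr_ge0 normrM ler_piMr // chi_cube_norm_le1.
  exact: cvg_cst.
exact: (@norm_cvg0 _ _ _ (nbhs x) (nbhs_filter x) _ h').
Unshelve. all: by end_near. Qed.

(* One differentiation costs one order of vanishing on the boundary of the cube. *)
Lemma is_derive_cutoff M F F' S' (v x : V) : smooth F ->
  (forall x, is_derive x v F (F' x)) -> (forall x, is_derive x v (sin_prod N) (S' x)) ->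
  is_derive x v (fun x => sin_prod N x ^+ M.+2 * F x * chi_cube N x)
   (sin_prod N x ^+ M.+1 * (M.+2%:R * S' x * F x + sin_prod N x * F' x) * chi_cube N x).
Proof.
move=> sF dF dS.
have dG : is_derive x v (fun x => sin_prod N x ^+ M.+2 * F x)
    (sin_prod N x ^+ M.+1 * (M.+2%:R * S' x * F x + sin_prod N x * F' x)).
  have h := is_deriveM (is_deriveX M.+2 (dS x)) (dF x).
  apply: is_derive_congr h _ _; first by move=> y; rewrite fctE exprfctE.
  rewrite exprfctE; transitivity (sin_prod N x ^+ M.+2 * F' x + F x * (M.+2%:R * sin_prod N x ^+
    M.+1 * S' x)) => //.
  by rewrite exprS; ring.
case: (chi_cube_cases x) => [[c hc]|x0].
  apply: near_eq_is_derive (_ : is_derive x v (fun y => sin_prod N y ^+ M.+2 * F y * c) _).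
    by apply: filterS hc => y ->.
  rewrite (nbhs_singleton hc).
  have h := is_deriveM dG (is_derive_cst c x v).
  by apply: is_derive_congr h _ _ => //; rewrite scaler0 add0r [RHS]mulrC.
(* Where the sine product vanishes, so do the smooth function and its derivative, and the difference
   quotients of the cutoff are dominated by those of the smooth function. *)
move: dG; rewrite x0 !expr0n !mul0r => -[dG1 dG2].
have h : h^-1 *: (((fun y => sin_prod N y ^+ M.+2 * F y * chi_cube N y) \o shift x) (h *: v) -
    sin_prod N x ^+ M.+2 * F x * chi_cube N x) @[h --> 0^'] --> (0 : R).
  have {}dG1 : h^-1 *: (((fun y => sin_prod N y ^+ M.+2 * F y) \o shift x) (h *: v) -
      sin_prod N x ^+ M.+2 * F x) @[h --> 0^'] --> (0 : R).
    by rewrite -[X in _ --> X]dG2; exact: dG1.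
  apply/cvgr0Pnorm_le => e e0; have /cvgr0Pnorm_le /(_ _ e0) := dG1.
  apply: filterS => t /=; rewrite x0 expr0n !mul0r !subr0; apply: le_trans.
  by rewrite normrZ [X in _ <= X]normrZ ler_wpM2l // normrM ler_piMr // chi_cube_norm_le1.
split; first by apply/cvg_ex; exists 0.
exact: cvg_lim.
Qed.

(** Induction for all [F] at once: a partial derivative is again a cutoff, with the sine power
    lowered by one and a new smooth factor. *)
Lemma Cm_cutoff M F : smooth F ->
  Cm M (fun x => sin_prod N x ^+ M.+1 * F x * chi_cube N x).
Proof.
elim: M F => [|M IH] F sF; first exact: continuous_cutoff.
split=> [|i]; first exact: continuous_cutoff.
have [F' sF' dF] := smooth_is_derive (delta_mx 0 i) sF.
have [S' sS' dS] := smooth_is_derive (delta_mx 0 i) (smooth_sin_prod N).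
have h x := @is_derive_cutoff M F F' S' (delta_mx 0 i) x sF dF dS.
split=> [x|]; first by have [] := h x.
rewrite (_ : (fun x => _) = fun x => sin_prod N x ^+ M.+1 *
    (M.+2%:R * S' x * F x + sin_prod N x * F' x) * chi_cube N x).
  apply: IH; apply: smoothD; first by apply: smoothM => //; apply: smoothM => //; exact: smooth_cst.
  by apply: smoothM => //; exact: smooth_sin_prod.
by apply/funext => x; have [] := h x.
Qed.

End Cutoff.
End Smooth.
(** * The partition of unity *)

Section Translates.
Context {R : realType} {d : nat}.
Notation V := 'rV[R]_d.

Lemma smooth_bounded (f : V -> R) : smooth f -> exists C : R, forall x, `|f x| <= C.
Proof.
elim=> [c|a b|u w _ [C1 h1] _ [C2 h2]|u w _ [C1 h1] _ [C2 h2]].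
- by exists `|c|.
- by exists 1 => x; rewrite ler_norml sin_geN1 sin_le1.
- by exists (C1 + C2) => x; apply: le_trans (ler_normD _ _) _; exact: lerD.
- by exists (C1 * C2) => x; rewrite normrM ler_pM.
Qed.

(** [f] parametrises finitely many indices that include the support; those outside [Z] are counted
    as 0. *)
Lemma sum_support (L : finType) (I : eqType) (W : nmodType) (f : L -> I) (psi : I -> W) (Z : seq
  I) :
  uniq Z -> injective f -> (forall n, psi n != 0 -> exists l, n = f l) ->
  \sum_(n <- Z) psi n = \sum_l (if f l \in Z then psi (f l) else 0).
Proof.
move=> uZ fI psiE.
transitivity (\sum_(n <- Z) \sum_(l | f l == n) psi (f l)).
  apply: eq_bigr => n _; have [p0|/psiE [l ->]] := eqVneq (psi n) 0.
    by rewrite p0 big1 // => l /eqP ->.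
  by rewrite (big_pred1 l) // => l'; rewrite (inj_eq fI).
rewrite (exchange_big_dep xpredT) //=; apply: eq_bigr => l _.
case: ifPn => fl.
  rewrite big_mkcond (bigD1_seq (f l)) //= eqxx big1 ?addr0 // => n nf.
  by rewrite eq_sym (negbTE nf).
by rewrite big_seq_cond big1 // => n /andP[nZ /eqP fn]; rewrite fn nZ in fl.
Qed.

Variables (N : nat) (N_gt0 : (0 < N)%N).

Definition in_cube (z : V) := forall i, 0 < z 0 i < N%:R.

(** These are the [N^d] integer points [n] with [x - intv n] in [[0,N)^d]. *)
Definition nearby (x : V) (l : {ffun 'I_d -> 'I_N}) : 'rV[int]_d :=
  \row_i (Num.floor (x 0 i) - (l i : nat)%:Z).

Lemma nearby_inj x : injective (nearby x).
Proof.
move=> l l' /rowP h; apply/ffunP => i; apply/val_inj; have := h i; rewrite !mxE /=.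
by move/addrI/oppr_inj => -[].
Qed.

Lemma translate_nearby x l i : (x - intv (nearby x l)) 0 i = frac (x 0 i) + (l i : nat)%:R.
Proof. by rewrite !mxE intrD mulrNz /frac opprD opprK addrA. Qed.

Lemma in_cube_nearby (x : V) n : in_cube (x - intv n) -> exists l, n = nearby x l.
Proof.
move=> h.
have k i : 0 <= Num.floor (x 0 i) - n 0 i < N%:Z.
  have /andP[h1 h2] := h i; have /andP[f1 f2] := floor_itv (x 0 i).
  move: h1 h2; rewrite !mxE => h1 h2.
  have a : n 0 i < Num.floor (x 0 i) + 1 by rewrite -(ltr_int R); apply: lt_trans f2; lra.
  have b : Num.floor (x 0 i) - n 0 i < N%:Z by rewrite -(ltr_int R) intrB; apply: le_lt_trans h2;
    lra.
  by rewrite subr_ge0 -ltzD1 a b.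
pose l : {ffun 'I_d -> 'I_N} := [ffun i => insubd (Ordinal N_gt0) (absz (Num.floor (x 0 i) - n 0
  i)%R)].
exists l; apply/rowP => i; rewrite mxE ffunE insubdK.
  by have /andP[k0 _] := k i; rewrite gez0_abs // opprB addrC subrK.
by rewrite -topredE /=; have := k i; lia.
Qed.

(** At most [N^d] integer translates of the open cube contain a given point. *)
Lemma sum_translates_le (phi : V -> R) (C : R) (s : seq 'rV[int]_d) (x : V) :
  (forall z, 0 <= phi z <= C) -> (forall z, phi z != 0 -> in_cube z) -> uniq s ->
  \sum_(n <- s) phi (x - intv n) <= (N ^ d)%:R * C.
Proof.
move=> phiC supp us.
rewrite (sum_support us (@nearby_inj x)) => [|n /supp]; last exact: in_cube_nearby.
apply: le_trans (_ : \sum_(l : {ffun 'I_d -> 'I_N}) C <= _).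
  apply: ler_sum => l _; case: ifP => _; first by have /andP[] := phiC (x - intv (nearby x l)).
  by have /andP[h1 h2] := phiC 0; exact: le_trans h2.
by rewrite big_const iter_addr_0 card_ffun !card_ord mulr_natl.
Qed.

(** By the double angle formula [cos (2 pi u) = 1] forces [sin (pi u) = 0], while this sine is
    positive for [0 < u < 1]. *)
Lemma e2pi_eq1 (s : R) : e2pi s = 1 -> frac s = 0.
Proof.
rewrite -e2pi_frac; set u := frac s => /(congr1 (@complex.Re R)) /= h.
have /andP[u0 u1] := frac_itv s; rewrite -/u in u0 u1; have pi0 := pi_gt0 R.
apply/eqP; rewrite eq_le u0 andbT leNgt; apply/negP => u0'.
have s0 : 0 < sin (pi * u) by apply: sin_gt0_pi; apply/andP; split; nra.
have := cos2Dsin2 (pi * u); move: h.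
by rewrite -mulrA mulr2n mulrDl mul1r cosD -!expr2 => h1 h2; nra.
Qed.

Lemma sum_roots_of_unity (k : int) :
  \sum_(t < N) e2pi (k%:~R * (t : nat)%:R / N%:R : R) = if (N%:Z %| k)%Z then N%:R else 0.
Proof.
have N0 : N%:R != 0 :> R by rewrite pnatr_eq0 -lt0n.
set z : R[i] := e2pi (k%:~R / N%:R).
have zE (t : nat) : e2pi (k%:~R * t%:R / N%:R : R) = z ^+ t.
  elim: t => [|t IH]; first by rewrite mulr0 mul0r e2pi0.
  by rewrite exprS -IH -e2piD; congr e2pi; rewrite -natr1; field.
under eq_bigr do rewrite zE.
case: ifP => [/dvdzP[q qE]|ndvd].
  have -> : z = 1 by rewrite /z qE intrM mulfK // e2pi_int.
  by under eq_bigr do rewrite expr1n; rewrite sumr_const card_ord.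
have z1 : z != 1.
  apply/eqP => /e2pi_eq1 /eqP; rewrite subr_eq0 => /eqP h.
  move/negP: ndvd; apply; apply/dvdzP; exists (Num.floor (k%:~R / N%:R : R)).
  by apply/eqP; rewrite -(eqr_int R) intrM -h divfK.
have : (z - 1) * \sum_(t < N) z ^+ t = 0.
  by rewrite -subrX1 -zE mulfK // e2pi_int subrr.
by move/eqP; rewrite mulf_eq0 subr_eq0 (negbTE z1) => /eqP.
Qed.

Section PartitionOfUnity.
Variables (K : nat) (c : 'rV[int]_d -> R[i]) (P : V -> R).
Hypothesis PE : forall x, (P x)%:C =
     \sum_(j : {ffun 'I_d -> 'I_(K.*2.+1)})
        c (box_pt j) * e2pi (dotR (intv (box_pt j)) x / N%:R).
Hypothesis cE : forall j : {ffun 'I_d -> 'I_(K.*2.+1)},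
     (forall i, (N%:Z %| box_pt j ord0 i)%Z) ->
     c (box_pt j) = (if box_pt j == 0 then (N%:R ^- d)%:C else 0).

Lemma box_pt_inj K' : injective (@box_pt d K').
Proof.
move=> j j' /rowP h; apply/ffunP => i; apply/val_inj; have := h i; rewrite !mxE /=.
by move/addIr => -[].
Qed.

(** For each frequency the sum over [l] factors into geometric sums over the coordinates and
    vanishes unless [N] divides all its entries. Among such frequencies only 0 has a nonzero
    coefficient, and [N^-d N^d = 1]. *)
Lemma sum_trig_poly_translates (y : V) :
  \sum_(l : {ffun 'I_d -> 'I_N}) P (y + \row_i (l i : nat)%:R) = 1.
Proof.
have N0 : N%:R != 0 :> R by rewrite pnatr_eq0 -lt0n.
suff : (\sum_(l : {ffun 'I_d -> 'I_N}) P (y + \row_i (l i : nat)%:R))%:C = 1%:C by case.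
rewrite rmorph_sum /=; under eq_bigr do rewrite PE.
rewrite exchange_big /=.
pose j0 : {ffun 'I_d -> 'I_(K.*2.+1)} := [ffun=> inord K].
have j00 : box_pt j0 = 0.
  by apply/rowP => i; rewrite !mxE ffunE inordK ?subrr // ltnS -addnn leq_addr.
have termE (j : {ffun 'I_d -> 'I_(K.*2.+1)}) :
    \sum_(l : {ffun 'I_d -> 'I_N}) c (box_pt j) *
      e2pi (dotR (intv (box_pt j)) (y + \row_i (l i : nat)%:R) / N%:R) =
    c (box_pt j) * e2pi (dotR (intv (box_pt j)) y / N%:R) *
    \prod_i (if (N%:Z %| box_pt j ord0 i)%Z then N%:R else 0).
  under [in RHS]eq_bigr do rewrite -sum_roots_of_unity.
  rewrite bigA_distr_bigA /= mulr_sumr; apply: eq_bigr => l _.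
  rewrite dotRDr mulrDl e2piD mulrA; congr (_ * _).
  rewrite -e2pi_sum; congr e2pi; rewrite /dotR mulr_suml; apply: eq_bigr => i _.
  by rewrite !mxE.
rewrite (eq_bigr _ (fun j _ => termE j)) (bigD1 j0) //= [X in _ + X]big1 ?addr0 => [|j jj0];
  last first.
  have [h|/existsNP [i /negP hi]] := pselect (forall i, (N%:Z %| box_pt j ord0 i)%Z).
    rewrite cE // -j00 (inj_eq (@box_pt_inj K)) (negbTE jj0) !mul0r //.
  by rewrite (bigD1 i) //= (negbTE hi) mul0r mulr0.
have dv i : (N%:Z %| box_pt j0 ord0 i)%Z by rewrite j00 mxE dvdz0.
rewrite cE // j00 eqxx intv0 dotRE mul0mx mxE mul0r e2pi0 mulr1.
under eq_bigr do rewrite mxE dvdz0.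
rewrite (_ : \prod_(i < d) N%:R = (N%:R ^+ d)%:C); last first.
  by rewrite prodr_const card_ord rmorphXn rmorph_nat.
by rewrite -rmorphM /= mulVf ?expf_neq0.
Qed.

(** The nearby translates of [x] are its fractional part shifted by [{0, ..., N-1}^d]; all lie in
    [[0,N)^d], where the indicator is 1. Nearby points missing from [Z] contribute 0, because there
    the translate is outside the open cube. *)
Lemma partition_of_unity (x : V) (Z : seq 'rV[int]_d) :
  (forall z, P z * chi_cube N z != 0 -> in_cube z) -> uniq Z ->
  (forall n, in_cube (x - intv n) -> n \in Z) ->
  \sum_(n <- Z) P (x - intv n) * chi_cube N (x - intv n) = 1.
Proof.
move=> supp uZ hZ.
pose psi n := P (x - intv n) * chi_cube N (x - intv n).
rewrite (@sum_support _ _ _ (nearby x) psi) // => [||n /supp]; first last.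
- exact: in_cube_nearby.
- exact: nearby_inj.
rewrite -(sum_trig_poly_translates (\row_i frac (x 0 i))); apply: eq_bigr => l _.
have -> : \row_i frac (x 0 i) + \row_i (l i : nat)%:R = x - intv (nearby x l).
  by apply/rowP => i; rewrite translate_nearby !mxE.
have chi1 : chi_cube N (x - intv (nearby x l)) = 1.
  rewrite /chi_cube asboolT // => i; rewrite translate_nearby.
  have /andP[f0 f1] := frac_itv (x 0 i).
  have : (l i : nat).+1%:R <= N%:R :> R by rewrite ler_nat.
  by rewrite -natr1 addr_ge0 //=; lra.
have psiE : psi (nearby x l) = P (x - intv (nearby x l)) by rewrite /psi chi1 mulr1.
case: ifPn => // nZ; rewrite -psiE; have [//|/supp h] := eqVneq (psi (nearby x l)) 0.
by rewrite hZ in nZ.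
Qed.

End PartitionOfUnity.
End Translates.
(** * Dual Gabor frames *)

Lemma sum_fibers (I J : eqType) (W : nmodType) (F : I -> W) (p : I -> J) (s : seq I) (Z : seq J) :
  uniq Z -> (forall i, i \in s -> F i != 0 -> p i \in Z) ->
  \sum_(i <- s) F i = \sum_(n <- Z) \sum_(i <- s | p i == n) F i.
Proof.
move=> uZ h; rewrite (exchange_big_dep xpredT) //=; apply: eq_big_seq => i si.
have [iZ|niZ] := boolP (p i \in Z).
  rewrite big_mkcond (bigD1_seq (p i)) //= eqxx big1 ?addr0 // => n ni.
  by rewrite eq_sym (negbTE ni).
have -> : F i = 0 by apply/eqP; apply: contraNT niZ; exact: h.
by rewrite big1.
Qed.

Section Gabor.
Context {R : realType} {d : nat}.
Notation T := (Rd R d).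
Notation V := 'rV[R]_d.
Variable mu : {measure set T -> \bar R}.
Hypothesis lebmu : is_lebesgue_Rd mu.
Variables (N : nat) (B : 'M[R]_d).
Hypotheses (N_gt0 : (0 < N)%N) (uB : B \in unitmx).
Hypothesis packing : forall n : 'rV[int]_d, n != 0 ->
  ~ (forall i, - N%:R < (intv n *m invmx B : V) 0 i < N%:R).

Local Notation chr := (chr B).
Local Notation kappa := (kappa B).

Definition translated_cube (n : 'rV[int]_d) : set T := [set x | in_cube N ((x : V) - intv n)].

Lemma measurable_translated_cube n : measurable (translated_cube n).
Proof.
rewrite (_ : translated_cube n = \bigcap_(i in [set: 'I_d])
   ((fun x : T => (x : V) 0 i) @^-1` `](intv n : V) 0 i, (intv n : V) 0 i + N%:R[)).
  apply: fin_bigcap_measurable; first exact: finite_finset.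
  by move=> i _; apply: measurable_preimage; [exact: measurable_coord|exact: measurable_itv].
apply/seteqP; split => x h i.
  by move=> _; have := h i; rewrite /= in_itv /= !mxE => /andP[? ?]; apply/andP; split; lra.
by have := h i Logic.I; rewrite /= in_itv /= !mxE => /andP[? ?]; apply/andP; split; lra.
Qed.

(** Two points of an open cube of side [N] differ by a vector of [(-N,N)^d], so by [packing] they
    are in the same lattice orbit only if they are equal. *)
Lemma cube_fundom n : exists2 D, fundom (invmx B) D & translated_cube n `<=` D.
Proof.
apply: packing_fundom => //; first by rewrite unitmx_inv.
  exact: measurable_translated_cube.
move=> x m h1 h2; apply/eqP; apply: contraT => /packing; case => i.
have /andP[a1 a2] := h1 i; have /andP[b1 b2] := h2 i.
move: a1 a2 b1 b2; rewrite !mxE => a1 a2 b1 b2; apply/andP; split; lra.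
Qed.

Definition window (phi : V -> R) (n : 'rV[int]_d) : V -> R[i] := fun x => (phi (x - intv n))%:C.

Lemma gaborE (phi : V -> R) m n x :
  gabor B (fun x => (phi x)%:C) (m, n) x = chr m x * window phi n x.
Proof. by []. Qed.

(** The support lies in the open cube because only open cubes are known to pack. *)
Definition admissible (C : R) (phi : V -> R) := [/\ measurable_fun [set: T] (phi : T -> R),
  forall x, `|phi x| <= C & forall x, phi x != 0 -> in_cube N x].

Section Window.
Variables (C : R) (phi : V -> R).
Hypothesis aphi : admissible C phi.

Lemma cmeasurable_window n : cmeasurable (window phi n).
Proof.
apply: cmeasurable_real.
apply: (@measurableT_comp _ _ _ _ _ _ (phi : T -> R) _ (translate (- intv n))).
  by case: aphi.
exact: measurable_translate.
Qed.

Lemma cnorm2_window n x : cnorm2 (window phi n x) <= C ^+ 2.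
Proof.
case: aphi => _ h _; rewrite cnorm2_real -[_ ^+ 2]real_normK ?num_real // lerXn2r ?nnegrE //.
exact: le_trans (h 0).
Qed.

Lemma window_ind n D x : translated_cube n `<=` D -> window phi n x * ind D x = window phi n x.
Proof.
move=> QD; have [p0|pn0] := eqVneq (phi (x - intv n)) 0; first by rewrite /window p0 mul0r.
by rewrite /ind indicE mem_set ?mulr1 //; apply: QD; case: aphi => _ _; apply.
Qed.

Lemma L2_gabor mn : L2 mu (gabor B (fun x => (phi x)%:C) mn).
Proof.
case: mn => m n; have [D fD QD] := cube_fundom n.
rewrite (_ : gabor _ _ _ = fun x => (chr m x * window phi n x) * ind D x).
  apply: (L2_bounded_ind uB lebmu fD (C := C ^+ 2)).
    by apply: cmeasurableM; [exact: cmeasurable_chr|exact: cmeasurable_window].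
  by move=> x; rewrite cnorm2M cnorm2_chr mul1r cnorm2_window.
by apply/funext => x; rewrite -mulrA window_ind.
Qed.

Definition windowed n (f : V -> R[i]) : V -> R[i] := fun x => window phi n x * f x.

Lemma L2_windowed n f : L2 mu f -> L2 mu (windowed n f).
Proof. apply: L2M_bounded; [exact: cmeasurable_window|exact: cnorm2_window]. Qed.

(** A Gabor coefficient is a Fourier coefficient on [D]: the indicator of [D] can be inserted since
    the translated window vanishes outside [D], and the real window moves freely to the other
    factor. *)
Lemma inner_gabor f m n D : translated_cube n `<=` D ->
  inner mu f (gabor B (fun x => (phi x)%:C) (m, n)) = inner mu (windowed n f) (chr_on B D m).
Proof.
move=> QD; have E x : f x * cconj (gabor B (fun x => (phi x)%:C) (m, n) x) =
    windowed n f x * cconj (chr_on B D m x).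
  rewrite gaborE /windowed /chr_on !cconjM cconj_ind -{1}(window_ind x QD) cconjM cconj_ind.
  by rewrite [cconj (window _ _ _)]cconj_real -/(window phi n x); ring.
by apply: eq_ReIm; apply: eq_Rintegral => x _; rewrite E.
Qed.

Lemma sum_n2_windowed (Z : seq 'rV[int]_d) f : uniq Z -> L2 mu f ->
  \sum_(n <- Z) n2 mu (windowed n f) <= (N ^ d)%:R * C ^+ 2 * n2 mu f.
Proof.
move=> uZ Lf; have [mphi phiC supp] := aphi.
have iW n : rintegrable mu (fun x => cnorm2 (windowed n f x)) by apply: L2_cnorm2;
  exact: L2_windowed.
have [iS ->] : rintegrable mu (fun x => \sum_(n <- Z) cnorm2 (windowed n f x)) /\
    \sum_(n <- Z) n2 mu (windowed n f) =
    Rintegral mu [set: T] (fun x : T => \sum_(n <- Z) cnorm2 (windowed n f x)).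
  elim: (Z) => [|n s [IH1 IH2]].
    split; first by rewrite /rintegrable; under eq_fun do rewrite big_nil; exact: integrable0.
    by rewrite big_nil; under eq_Rintegral do rewrite big_nil; rewrite Rintegral_cst // mul0r.
  split; first by under eq_fun do rewrite big_cons; exact: rintegrableD.
  rewrite big_cons IH2 -RintegralD //; last exact: iW.
  by apply: eq_Rintegral => x _; rewrite big_cons.
rewrite -RintegralZl //; last exact: L2_cnorm2.
apply: le_Rintegral => //; first by apply: rintegrableZ; exact: L2_cnorm2.
move=> x _; under eq_bigr do rewrite cnorm2M cnorm2_real.
rewrite -mulr_suml ler_wpM2r ?cnorm2_ge0 //.
apply: (@sum_translates_le _ _ _ N_gt0 (fun z => phi z ^+ 2)) => // z.
  rewrite sqr_ge0 /= -[_ ^+ 2]real_normK ?num_real // lerXn2r ?nnegrE //.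
  exact: le_trans (phiC 0).
by rewrite sqrf_eq0; exact: supp.
Qed.

(** In the constant, [kappa] is the squared norm of the characters, [N^d] counts overlapping cubes
    and [C^2] bounds the squared window. *)
Lemma bessel_gabor_bound f (s : seq ('rV[int]_d * 'rV[int]_d)) : uniq s -> L2 mu f ->
  \sum_(i <- s) cnorm2 (inner mu f (gabor B (fun x => (phi x)%:C) i)) <=
  kappa * ((N ^ d)%:R * C ^+ 2) * n2 mu f.
Proof.
move=> us Lf; set Z := undup [seq i.2 | i <- s].
have uZ : uniq Z by exact: undup_uniq.
rewrite (@sum_fibers _ _ _ _ snd _ Z) // => [|i si _]; last by rewrite mem_undup map_f.
apply: le_trans (_ : \sum_(n <- Z) kappa * n2 mu (windowed n f) <= _).
  apply: ler_sum => n _; have [D fD QD] := cube_fundom n.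
  set sn := [seq i.1 | i <- s & i.2 == n].
  have usn : uniq sn.
    rewrite map_inj_in_uniq ?filter_uniq // => -[m1 n1] [m2 n2]; rewrite !mem_filter /=.
    by move=> /andP[/eqP -> _] /andP[/eqP -> _] ->.
  rewrite (_ : \sum_(i <- s | _) _ = \sum_(m <- sn) cnorm2 (inner mu (windowed n f) (chr_on B D
    m))).
    apply: (bessel_inequality (kappa_gt0 uB) (L2_chr_on uB lebmu fD) (inner_chr_on uB lebmu fD))
      => //.
    exact: L2_windowed.
  rewrite big_map big_filter; apply: eq_bigr => -[m n'] /= /eqP ->.
  by rewrite (inner_gabor _ _ QD).
by rewrite -mulr_sumr -mulrA ler_wpM2l ?(ltW (kappa_gt0 uB)) // sum_n2_windowed.
Qed.

Lemma bessel_gabor : bessel mu (gabor B (fun x => (phi x)%:C)).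
Proof.
split; first exact: L2_gabor.
exists (kappa * ((N ^ d)%:R * C ^+ 2)) => f Lf s us.
by rewrite sqr_L2norm; exact: bessel_gabor_bound.
Qed.

End Window.

Variables (C : R) (g h : V -> R).
Hypotheses (ag : admissible C g) (ah : admissible C h).
Hypothesis duality : forall (x : V) (Z : seq 'rV[int]_d), uniq Z ->
  (forall n, in_cube N (x - intv n) -> n \in Z) ->
  \sum_(n <- Z) g (x - intv n) * h (x - intv n) = `|\det B|.

Local Notation gab phi := (gabor B (fun x => (phi x)%:C)).

(** Only windows indexed by [Z] meet [f]. For each of them the error is the residual of an
    orthogonal projection, so [s0] consists of the frequencies of one good approximant per window,
    and a larger [s] does no worse. *)
Lemma reconstruction_local f (Z : seq 'rV[int]_d) (eps : R) : L2 mu f -> uniq Z ->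
  (forall x n, f x != 0 -> in_cube N (x - intv n) -> n \in Z) -> 0 < eps ->
  exists s0 : seq ('rV[int]_d * 'rV[int]_d), forall s : seq ('rV[int]_d * 'rV[int]_d),
    uniq s -> {subset s0 <= s} ->
    n2 mu (fun x => f x - \sum_(i <- s) inner mu f (gab h i) * gab g i x) < eps.
Proof.
move=> Lf uZ fZ eps0.
(* [A] collects the losses: [2^(size Z)] from [n2_sum_le], one summand per element of [Z], and
   [kappa^2 C^2] from the factor in front of each residual. Adding 1 in [delta] avoids a zero
   denominator. *)
pose A := 2 ^+ size Z * ((size Z)%:R * (kappa ^+ 2 * C ^+ 2)).
have A0 : 0 <= A.
  apply: mulr_ge0; first exact: exprn_ge0.
  by apply: mulr_ge0 => //; apply: mulr_ge0; exact: sqr_ge0.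
pose delta := eps / (A + 1); have delta0 : 0 < delta by rewrite divr_gt0 // ltr_wpDl.
have approx n : exists (Dl : set T * seq (R[i] * 'rV[int]_d)),
   [/\ fundom (invmx B) Dl.1, translated_cube n `<=` Dl.1 &
     n2 mu (fun x => windowed h n f x - \sum_(q <- Dl.2) q.1 * chr_on B Dl.1 q.2 x) < delta].
  have [D fD QD] := cube_fundom n.
  have [||l hl] := @chr_complete _ _ B uB mu lebmu D fD (windowed h n f) delta _ _ delta0.
  - exact: (L2_windowed ah).
  - by move=> x nDx; rewrite /windowed -(window_ind ah x QD) /ind indicE memNset // mulr0 mul0r.
  - by exists (D, l).
have [Dl hDl] := choice approx.
exists (flatten [seq [seq (q.2, n) | q <- (Dl n).2] | n <- Z]) => s us s0s.
pose sn n := [seq i.1 | i <- s & i.2 == n].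
have usn n : uniq (sn n).
  rewrite map_inj_in_uniq ?filter_uniq // => -[m1 n1] [m2 n2]; rewrite !mem_filter /=.
  by move=> /andP[/eqP -> _] /andP[/eqP -> _] ->.
pose u n := chr_on B (Dl n).1.
pose res n x := windowed h n f x - orth_proj mu (u n) kappa (sn n) (windowed h n f) x.
have Lu n m : L2 mu (u n m) by have [fD _ _] := hDl n; exact: (L2_chr_on uB lebmu fD).
have Lres n : L2 mu (res n) by apply: L2B; [exact: (L2_windowed ah)|exact: L2_orth_proj].
have res_lt n : n \in Z -> n2 mu (res n) < delta.
  move=> nZ; have [fD QD hl] := hDl n; apply: le_lt_trans hl.
  apply: (n2_orth_proj_residual_le (kappa_gt0 uB) (L2_chr_on uB lebmu fD) (inner_chr_on uB lebmu
    fD)) => //.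
    exact: (L2_windowed ah).
  apply/allP => q ql; apply/mapP; exists (q.2, n) => //; rewrite mem_filter eqxx /=.
  apply: s0s; apply/flatten_mapP; exists n => //; exact: map_f.
have kdet : kappa * `|\det B| = 1.
  have dB : \det B != 0 by rewrite -unitfE -unitmxE.
  by rewrite -[kappa]/(`|\det (invmx B)|) det_inv normfV mulVf // normr_eq0.
(* By [duality] and [kdet], [f] is the sum of its pieces [kappa g_n h_n f]. The Gabor sum splits
   along the same [n], and its terms with [n] outside [Z] have zero coefficient. *)
have fE x : f x - \sum_(i <- s) inner mu f (gab h i) * gab g i x =
    \sum_(n <- Z) (kappa%:C * window g n x) * res n x.
  have -> : f x = \sum_(n <- Z) kappa%:C * window g n x * windowed h n f x.
    have [fx0|fx] := eqVneq (f x) 0.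
      by rewrite fx0 big1 // => n _; rewrite /windowed fx0 !mulr0.
    transitivity ((kappa * \sum_(n <- Z) g (x - intv n) * h (x - intv n))%:C * f x).
      by rewrite duality // => [|n]; [rewrite kdet mul1r|exact: fZ].
    rewrite rmorphM rmorph_sum mulr_sumr mulr_suml; apply: eq_bigr => n _.
    by rewrite rmorphM /windowed /window !mulrA.
  rewrite (@sum_fibers _ _ _ _ snd s Z) // => [|[m n] si /=]; last first.
    apply: contraNT => nZ; have [_ QD _] := hDl n.
    rewrite (inner_gabor ah _ _ QD).
    rewrite (_ : windowed h n f = fun=> 0) ?inner0l ?mul0r //.
    apply/funext => y; rewrite /windowed.
    have [->|fy] := eqVneq (f y) 0; first by rewrite mulr0.
    have [h0|hy] := eqVneq (h (y - intv n)) 0; first by rewrite /window h0 mul0r.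
    by case/negP: nZ; apply: (fZ y) => //; case: ah => _ _; apply.
  rewrite -sumrB; apply: eq_bigr => n _; rewrite /res mulrBr; congr (_ - _).
  have [_ QD _] := hDl n.
  rewrite /orth_proj /sn big_map big_filter mulr_sumr; apply: eq_bigr => -[m n'] /= /eqP ->.
  rewrite (inner_gabor ah _ _ QD) gaborE -{1}(window_ind ag x QD) /u /chr_on.
  have -> : (kappa^-1)%:C = (kappa%:C)^-1 :> R[i] by rewrite fmorphV.
  have k0 : kappa%:C != 0 :> R[i] by rewrite (inj_eq (@complexI _)) gt_eqF // kappa_gt0.
  by field.
rewrite (funext fE).
have Lt n : L2 mu (fun x => (kappa%:C * window g n x) * res n x).
  under eq_fun do rewrite -mulrA; apply: L2Z; apply: (L2M_bounded (C := C ^+ 2)) => //.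
    exact: cmeasurable_window ag _.
  exact: cnorm2_window ag _.
apply: le_lt_trans (n2_sum_le Z Lt) _.
have bound : \sum_(n <- Z) n2 mu (fun x => (kappa%:C * window g n x) * res n x) <=
    (size Z)%:R * (kappa ^+ 2 * C ^+ 2) * delta.
  apply: le_trans (_ : \sum_(n <- Z) kappa ^+ 2 * C ^+ 2 * delta <= _); last first.
    by rewrite big_const_seq count_predT iter_addr_0 -[X in _ <= X]mulrA mulr_natl.
  rewrite !big_seq; apply: ler_sum => n nZ.
  apply: le_trans (_ : kappa ^+ 2 * C ^+ 2 * n2 mu (res n) <= _).
    apply: n2_leM => // x; rewrite !cnorm2M cnorm2_real ler_wpM2r ?cnorm2_ge0 //.
    by rewrite ler_wpM2l ?sqr_ge0 // (cnorm2_window ag).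
  apply: ler_wpM2l; last by rewrite ltW // res_lt.
  by apply: mulr_ge0; exact: sqr_ge0.
apply: le_lt_trans (_ : A * delta < _).
  by rewrite /A -[_ * _ * delta]mulrA; apply: ler_wpM2l => //; exact: exprn_ge0.
by rewrite /delta mulrCA mulrA ltr_pdivrMr ?ltr_wpDl // ltr_pM2l // ltrDl.
Qed.

Lemma dual_gabor_frames : dual_frames mu (gab g) (gab h).
Proof.
(* The closing linear arithmetic, separated out; [e] will be [eps^2]. *)
have final (X1 X2 X3 X4 Y e : R) : X1 < e / 4 -> X3 <= Y -> X2 <= 2 * X4 + 2 * X3 ->
  X4 + Y < e / 8 -> 2 * X1 + 2 * X2 < e by lra.
split; first exact: bessel_gabor ag.
split; first exact: bessel_gabor ah.
move=> f Lf eps eps0.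
(* The summand 1 makes the Bessel bound positive, as [synthesis_bound] requires. *)
pose Cb := kappa * ((N ^ d)%:R * C ^+ 2) + 1.
have Cb0 : 0 < Cb.
  rewrite /Cb ltr_wpDl //; apply: mulr_ge0; first exact: (ltW (kappa_gt0 uB)).
  by apply: mulr_ge0 => //; exact: sqr_ge0.
have bb phi (aphi : admissible C phi) f' s : uniq s -> L2 mu f' ->
    \sum_(i <- s) cnorm2 (inner mu f' (gab phi i)) <= Cb * n2 mu f'.
  move=> us Lf'; apply: le_trans (bessel_gabor_bound aphi us Lf') _.
  by rewrite ler_wpM2r ?n2_ge0 // lerDl.
pose box (k : nat) := cbox (\row_(i < d) - k%:R : V) (\row_(i < d) k%:R).
have mbox k : measurable (box k) by exact: measurable_cbox.
pose tail k x := f x - f x * ind (box k) x.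
have Lcut k : L2 mu (fun x => f x * ind (box k) x).
  under eq_fun do rewrite mulrC; apply: (L2M_bounded (C := 1)) => //.
    exact: cmeasurable_ind.
  by move=> x; exact: cnorm2_ind_le1.
have Ltail k : L2 mu (tail k) by exact: L2B.
(* Makes [(1 + Cb^2) * n2 mu (tail k)] less than [eps^2 / 8], so that the tail minus its partial sum
   has squared norm below [eps^2 / 4]. *)
pose e1 := eps ^+ 2 / (8 * (1 + Cb * Cb)).
have e10 : 0 < e1 by rewrite divr_gt0 ?exprn_gt0 // mulr_gt0 // ltr_wpDr // mulr_ge0 ?ltW.
have [k hk] : exists k, n2 mu (tail k) < e1.
  apply: (@n2_cvg0 _ _ mu tail (fun x => cnorm2 (f x))) => //.
  - exact: L2_cnorm2.
  - move=> k x; rewrite /tail -{1}[f x]mulr1 -mulrBr cnorm2M ler_piMr ?cnorm2_ge0 //.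
    rewrite /ind -(rmorph1 (real_complex R)) -rmorphB cnorm2_real indicE.
    by case: (x \in _); rewrite ?subrr ?subr0 ?expr0n ?expr1n.
  - move=> x; apply: cvg_near_cst.
    have [m _ xm] : (\bigcup_m box m) x.
      exists (\max_(i < d) Num.trunc `|x ord0 i|)%N.+1 => // i; rewrite !mxE -ler_norml ltW //.
      have /andP[_ hx] := truncn_itv (normr_ge0 (x 0 i)).
      apply: (lt_le_trans hx); rewrite ler_nat ltnS.
      exact: (@leq_bigmax _ (fun i : 'I_d => Num.trunc `|x ord0 i|) i).
    near=> k; rewrite /tail /ind indicE mem_set ?mulr1 ?subrr ?cnorm2_0 // => i.
    have mk : m%:R <= k%:R :> R by rewrite ler_nat; near: k; exact: nbhs_infty_ge.
    have := xm i; rewrite !mxE => /andP[x1 x2]; apply/andP; split; lra.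
(* For [x] in [[-k,k]^d] and [x - n] in the open cube, the entries of [n] are at most [k + N] in
   absolute value. *)
pose Z := [seq box_pt j | j : {ffun 'I_d -> 'I_((k + N).*2.+1)}].
have uZ : uniq Z by rewrite map_inj_uniq ?enum_uniq //; exact: box_pt_inj.
have cutZ x n : f x * ind (box k) x != 0 -> in_cube N (x - intv n) -> n \in Z.
  move=> fx cx; have bx : box k x.
    by apply: contrapT => nb; case/eqP: fx; rewrite /ind indicE memNset // mulr0.
  have bd i : - (k + N)%:Z <= n 0 i <= (k + N)%:Z.
    have := bx i; have := cx i; rewrite !mxE => /andP[c1 c2] /andP[b1 b2].
    by rewrite -!(ler_int R) mulrNz PoszD intrD; apply/andP; split; lra.
  apply/mapP; exists [ffun i => inord (absz (n 0 i + (k + N)%:Z)%R)]; first by rewrite mem_enum.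
  apply/rowP => i; rewrite mxE ffunE inordK; last by have := bd i; lia.
  by rewrite gez0_abs ?addrK //; have := bd i; lia.
have e20 : 0 < eps ^+ 2 / 4 by rewrite divr_gt0 ?exprn_gt0.
have [s0 hs0] := reconstruction_local (Lcut k) uZ cutZ e20.
exists s0 => s us s0s.
pose S f' x := \sum_(i <- s) inner mu f' (gab h i) * gab g i x.
have Lgab phi (aphi : admissible C phi) i : L2 mu (gab phi i) by exact: L2_gabor aphi i.
have LS f' : L2 mu (S f') by apply: L2_sum => i; apply: L2Z; exact: Lgab ag i.
have splitE x : f x - S f x = (f x * ind (box k) x - S (fun x => f x * ind (box k) x) x) +
    (tail k x - S (tail k) x).
  rewrite addrACA -opprD; congr (_ - _); first by rewrite /tail addrC subrK.
  rewrite /S -big_split /=; apply: eq_bigr => i _; rewrite -mulrDl -innerDl //.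
    by congr (inner mu _ _ * _); apply/funext => y; rewrite /tail addrC subrK.
  exact: Lgab ah i.
suff : n2 mu (fun x => f x - S f x) < eps ^+ 2.
  by rewrite -sqr_L2norm ltr_pXn2r ?nnegrE ?(ltW eps0) // sqrtr_ge0.
rewrite (funext splitE).
have h1 : n2 mu (fun x => f x * ind (box k) x - S (fun x => f x * ind (box k) x) x) < eps ^+ 2 / 4.
  exact: hs0 s us s0s.
have h2 : n2 mu (S (tail k)) <= Cb * Cb * n2 mu (tail k).
  apply: synthesis_bound => //; [exact: Lgab ag|exact: Lgab ah| |].
    by move=> f' Lf'; exact: bb.
  by move=> f' Lf'; exact: bb.
apply: le_lt_trans (n2D_le (L2B (Lcut k) (LS _)) (L2B (Ltail k) (LS _))) _.
have h3 := n2B_le (Ltail k) (LS (tail k)).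
have h4 : (1 + Cb * Cb) * n2 mu (tail k) < eps ^+ 2 / 8.
  move: hk; rewrite /e1 invfM mulrA ltr_pdivlMr; last by rewrite ltr_wpDr // mulr_ge0 ?ltW.
  by rewrite mulrC.
move: h4; rewrite mulrDl mul1r; exact: final h1 h2 h3.
Unshelve. all: by end_near. Qed.

End Gabor.

(** On a face of the closed cube one of the sines vanishes. *)
Lemma sin_prod_chi_in_cube (R : realType) (d N : nat) (x : 'rV[R]_d) : (0 < N)%N ->
  sin_prod N x * chi_cube N x != 0 -> in_cube N x.
Proof.
move=> N0; rewrite mulf_eq0 negb_or => /andP[S0]; rewrite /chi_cube; case: asboolP => [h _|];
  last by rewrite eqxx.
move=> i; have /andP[h1 h2] := h i; rewrite !lt_neqAle h1 h2 !andbT.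
apply/andP; split; apply: contraNneq S0 => e; rewrite /sin_prod (bigD1 i) //=.
  by rewrite -e mulr0 mul0r sin0 mul0r.
by rewrite e mulfK ?pnatr_eq0 -?lt0n // sinpi mul0r.
Qed.

Unset Implicit Arguments.

Theorem theorem4p1 (R : realType) (d K N M : nat)
  (c : 'rV[int]_d -> R[i]) (P G H : 'rV[R]_d -> R) (B : 'M[R]_d)
  (mu : {measure set (Rd R d) -> \bar R}) :
  (2 <= d)%N -> (0 < N)%N -> (0 < M)%N -> (M <= K)%N ->
  (* P x = sum_{k in (Z cap [-K,K])^d} c_k e^{2 pi i k.x/N}, P real-valued *)
  (forall x, (P x)%:C =
     \sum_(j : {ffun 'I_d -> 'I_(K.*2.+1)})
        c (box_pt j) * e2pi (dotR (intv (box_pt j)) x / N%:R)) ->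
  (* c_k = N^{-d} delta_{k,0} for k in (N Z)^d *)
  (forall j : {ffun 'I_d -> 'I_(K.*2.+1)},
     (forall i, (N%:Z %| box_pt j ord0 i)%Z) ->
     c (box_pt j) = (if box_pt j == 0 then (N%:R ^- d)%:C else 0)) ->
  Cm (2 * M - 1) (fun x => P x * chi_cube N x) ->
  real_trig_poly N G -> real_trig_poly N H ->
  (forall x, P x = sin_prod N x ^+ (2 * M) * G x * H x) ->
  B \in unitmx ->
  (forall n : 'rV[int]_d, n != 0 ->
     ~ (forall i, - N%:R < (invmx B^T *m (intv n)^T) i 0 < N%:R)) ->
  is_lebesgue_Rd mu ->
  let g := fun x => sin_prod N x ^+ M * G x * chi_cube N x in
  let h := fun x => `|\det B| * (sin_prod N x ^+ M * H x * chi_cube N x) in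
  Cm (M - 1) g /\ Cm (M - 1) h /\
  dual_frames mu (gabor B (fun x => (g x)%:C)) (gabor B (fun x => (h x)%:C)).
Proof.
(* [M] is positive; writing it as a successor exhibits the sine factor that vanishes on the
   faces. *)
case: M => [_ _ //|M] _ N0 _ _ PE cE _ tG tH PGH uB pack lebmu g h.
have sG := smooth_real_trig_poly tG; have sH := smooth_real_trig_poly tH.
(* [|det B|] is absorbed into the smooth factor, which gives [h] the shape of [g]. *)
have sdH : smooth (fun x => `|\det B| * H x) by apply: smoothM => //; exact: smooth_cst.
have hE : h = fun x => sin_prod N x ^+ M.+1 * (`|\det B| * H x) * chi_cube N x.
  by apply/funext => x; rewrite /h; ring.
have Cg : Cm M g by exact: Cm_cutoff.
have Ch : Cm M h by rewrite hE; exact: Cm_cutoff.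
rewrite subn1 /=; do 2 split => //.
(* Any larger constant is allowed, so that a common one serves both windows. *)
have adm (F : 'rV[R]_d -> R) : smooth F -> exists C : R, forall C', C <= C' ->
    admissible N C' (fun x => sin_prod N x ^+ M.+1 * F x * chi_cube N x).
  move=> sF; have sSF : smooth (fun x => sin_prod N x ^+ M.+1 * F x).
    by apply: smoothM => //; apply: smoothX; exact: smooth_sin_prod.
  have [C hC] := smooth_bounded sSF; exists C => C' CC'; split.
  - by apply: continuous_measurable_Rd; exact: continuous_cutoff.
  - move=> x; rewrite normrM; apply: le_trans CC'; apply: le_trans (hC x).
    by rewrite ler_piMr // chi_cube_norm_le1.
  - move=> x nz; apply: sin_prod_chi_in_cube => //; apply: contraNneq nz.
    by move=> /eqP; rewrite mulf_eq0 => /orP[] /eqP ->; rewrite ?expr0n ?mul0r ?mulr0.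
have [Cg1 hg] := adm G sG; have [Ch1 hh] := adm _ sdH.
have ag : admissible N (Num.max Cg1 Ch1) g by apply: hg; rewrite le_max lexx.
have ah : admissible N (Num.max Cg1 Ch1) h by rewrite hE; apply: hh; rewrite le_max lexx orbT.
apply: (dual_gabor_frames lebmu N0 uB _ ag ah).
  (* Transposition passes from column vectors to the row vectors of [packing]. *)
  move=> n n0 hn; apply: (pack n n0) => i; have := hn i.
  have <- : (intv n *m invmx B)^T = invmx B^T *m (intv n)^T :> 'cV[R]_d by rewrite trmx_mul
    trmx_inv.
  by rewrite [_^T i 0]mxE.
move=> x Z uZ hZ.
(* The indicator is idempotent, so the two cutoffs merge into one. *)
have ghE z : g z * h z = `|\det B| * (P z * chi_cube N z).
  rewrite /g /h PGH mul2n -addnn exprD /chi_cube; case: asboolP => _; ring.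
under eq_bigr do rewrite ghE.
rewrite -mulr_sumr (@partition_of_unity _ _ _ N0 K c P PE cE) ?mulr1 // => z nz.
apply: sin_prod_chi_in_cube => //; apply: contraNneq nz.
by move=> /eqP; rewrite mulf_eq0 => /orP[] /eqP S0;
  rewrite ?PGH S0 ?expr0n ?muln_eq0 /= ?mul0r ?mulr0.
Qed.
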